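(* Let $\Lambda\subset\{z\in\mathbb{C}:\operatorname{Im} z<0\}$ be a set contained in the domain $\{z\in\mathbb{C}: -\operatorname{Im} z\ge C|z|^\beta\}$ for some $C>0$ and $\beta>0$. Let $n(r)=\#\{\lambda\in\Lambda: |\lambda|<r\}$ be the counting function of $\Lambda$. If for some $\alpha<\beta$ there is a constant $M>0$ such that $n(r)\le M r^\alpha$ for all $r>0$, then there exists a real-valued compactly supported $q\in L^1(\mathbb{R}_+)$ such that $\Lambda\subset\operatorname{Res}(q)$.
   Context: $\mathbb{R}_+=[0,+\infty)$. For a real-valued compactly supported $q\in L^1(\mathbb{R}_+)$, consider the one-dimensional Schrödinger operator $-\frac{d^2}{dx^2}+q(x)$ on $\mathbb{R}_+$. For $k\in\mathbb{C}$, its Jost solution $\psi(k,x)$ is the unique solution of $-\psi''(k,x)+q(x)\psi(k,x)=k^2\psi(k,x)$, $x\ge 0$ (derivatives in $x$), that satisfies $\psi(k,x)=e^{ikx}$ for all large $x$. The Jost function is $w(k)=\psi(k,0)$; it is an entire function of $k$. The resonances are the zeros of $w$ in the open lower half-plane $\{z:\operatorname{Im} z<0\}$, and $\operatorname{Res}(q)$ denotes the set of resonances. Thus $\Lambda\subset\operatorname{Res}(q)$ means that $w(\lambda)=0$ for every $\lambda\in\Lambda$. *)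

(* Defs.v *)
From HB Require Import structures.
From mathcomp Require Import all_boot all_order all_algebra.
From mathcomp Require Export all_classical all_reals all_analysis.
From mathcomp.real_closed Require Export complex.
Set Implicit Arguments.
Unset Strict Implicit.
Unset Printing Implicit Defensive.
Import Order.TTheory GRing.Theory Num.Theory numFieldNormedType.Exports.
Import ComplexField.Normc.

Local Open Scope classical_set_scope.
Local Open Scope complex_scope.
Local Open Scope ring_scope.

Definition cexp (R : realType) (z : R[i]) : R[i] :=
  (expR (complex.Re z) * cos (complex.Im z)) +i* (expR (complex.Re z) * sin (complex.Im z)).

Definition abs_continuous_on (R : realType) (a b : R) (f : R -> R) : Prop :=
  forall e : R, 0 < e -> exists2 d : R, 0 < d &
    forall (n : nat) (s t : 'I_n -> R),
      (forall i, a <= s i /\ s i <= t i /\ t i <= b) ->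
      trivIset [set: 'I_n] (fun i => `]s i, t i[%classic) ->
      \sum_(i < n) (t i - s i) < d ->
      \sum_(i < n) `|f (t i) - f (s i)| < e.

(* f is in AC_loc([0, +oo)); complex-valued functions of a real variable are
   treated componentwise, the library giving R[i] no normed-module structure over R. *)
Definition loc_abs_continuous (R : realType) (f : R -> R[i]) : Prop :=
  forall b : R, 0 < b ->
    abs_continuous_on 0 b (fun x => complex.Re (f x)) /\
    abs_continuous_on 0 b (fun x => complex.Im (f x)).

Definition has_deriv (R : realType) (f : R -> R[i]) (x : R) (d : R[i]) : Prop :=
  is_derive x (1 : R) (fun y => complex.Re (f y)) (complex.Re d) /\
  is_derive x (1 : R) (fun y => complex.Im (f y)) (complex.Im d).

(* As q is only integrable, a solution on [0, +oo) is a function psi such that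
   psi and psi' are locally absolutely continuous on [0, +oo) and the equation
   holds almost everywhere. The values of q, psi and dpsi on negative reals are
   irrelevant; dpsi 0 is the one-sided derivative, by continuity of dpsi. *)
Definition schrodinger_solution (R : realType) (q : R -> R) (k : R[i])
    (psi : R -> R[i]) : Prop :=
  exists dpsi : R -> R[i],
    [/\ loc_abs_continuous psi,
        loc_abs_continuous dpsi,
        forall x, 0 < x -> has_deriv psi x (dpsi x) &
        {ae (@lebesgue_measure R), forall x, 0 < x ->
          exists2 d2 : R[i], has_deriv dpsi x d2 &
            - d2 + (q x)%:C * psi x = k ^+ 2 * psi x}].

Definition jost_solution (R : realType) (q : R -> R) (k : R[i])
    (psi : R -> R[i]) : Prop :=
  schrodinger_solution q k psi /\
  exists x0 : R, forall x, x0 <= x -> psi x = cexp ('i%C * k * x%:C).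

(* For q integrable with compact support the Jost solution exists and is unique
   on [0, +oo), so this relation determines w. *)
Definition jost_function (R : realType) (q : R -> R) (w : R[i] -> R[i]) : Prop :=
  forall k : R[i], exists2 psi : R -> R[i], jost_solution q k psi & w k = psi 0.

Definition resonances (R : realType) (q : R -> R) : set R[i] :=
  [set k : R[i] | complex.Im k < 0 /\ exists2 w, jost_function q w & w k = 0].

Definition compactly_supported (R : realType) (q : R -> R) : Prop :=
  compact (closure [set x : R | 0 <= x /\ q x != 0]).

(* n(r), equal to +oo when the set is infinite. *)
Definition counting_function (R : realType) (Lambda : set R[i]) (r : R) : \bar R :=
  counting [set z : R[i] | Lambda z /\ normc z < r].

(* Main.v *)
(* A potential on [0, a] is recovered from A(y) = 2 K(0, 2y), where K is the
   transformation kernel of the Jost solutions; the Jost function is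
   w(k) = 1 + int_0^a A(y) e^{2iky} dy. When A' is uniformly small compared with
   a^{-2}, the hyperbolic problem for K with unknown potential is solved by a
   contraction, so every small A comes from some q. It remains to find a small A
   for which w vanishes on Lambda. A bump concentrated on [l/2, l], paired with its
   conjugate, gives a factor vanishing at z whose size is of order e^{-l |Im z|};
   with l a large multiple of ln(2 + |z|) / |Im z| these sizes are summable and
   tiny, and the lengths l have a finite sum because
   sum_Lambda (1 + ln(2 + |z|)) |z|^{-beta} < oo when alpha < beta. The product of
   all factors is again of the form 1 + int A e^{2iky} (convolution of the bumps). *)
Require Import Defs.
From mathcomp Require Import all_boot all_order all_algebra.
From mathcomp Require Import all_classical all_reals all_analysis.
From mathcomp.real_closed Require Import complex.
From mathcomp Require Import finmap ring lra.
Import Order.TTheory GRing.Theory Num.Theory numFieldNormedType.Exports.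
Import ComplexField.Normc.
Local Open Scope classical_set_scope.
Local Open Scope complex_scope.
Local Open Scope ring_scope.
Set Implicit Arguments.
Unset Strict Implicit.
Unset Printing Implicit Defensive.

(** * Calculus of continuous functions *)

(** A free parameter D closes the scheme. The total length a is affine in D and the total size E is
    a multiple of e^{-D}, so a^2 E, which the inverse problem needs small, tends to 0 however large
    the finite sum over [Lambda] is. The inverse problem is therefore solved only near q = 0. There
    q equals -A' up to quadratic terms, which is why every factor is measured by its derivative as
    well as by its values. Only an inclusion is asked for, so the further zeros brought in by the
    factors are harmless. Pairing each bump with its conjugate keeps A, and hence q, real. Since A
    is merely C^1, q is merely continuous and must never be differentiated. The hyperbolic equation
    is therefore kept in integrated form, and changes of variable move derivatives onto the
    exponential or onto the limits of integration. *)

Section Continuity.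
Context {R : realType}.
Implicit Types T : topologicalType.

Lemma cont_cst T (c : R) : continuous (fun _ : T => c).
Proof. by move=> x; exact: cst_continuous. Qed.
Lemma contD T (f g : T -> R) : continuous f -> continuous g -> continuous (fun t => f t + g t).
Proof. by move=> cf cg x; apply: (@continuousD _ _ _ f g); [exact: cf|exact: cg]. Qed.
Lemma contN T (f : T -> R) : continuous f -> continuous (fun t => - f t).
Proof. by move=> cf x; apply: (@continuousN _ _ _ f); exact: cf. Qed.
Lemma contB T (f g : T -> R) : continuous f -> continuous g -> continuous (fun t => f t - g t).
Proof. by move=> cf cg; apply: contD => //; exact: contN. Qed.
Lemma contM T (f g : T -> R) : continuous f -> continuous g -> continuous (fun t => f t * g t).
Proof. by move=> cf cg x; apply: (@continuousM _ _ f g); [exact: cf|exact: cg]. Qed.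
Lemma contX T (f : T -> R) n : continuous f -> continuous (fun t => f t ^+ n).
Proof. by move=> cf x; apply: (@continuous_comp _ _ _ f (fun y => y ^+ n)); [exact: cf|exact: exprn_continuous]. Qed.
Lemma cont_comp T (S U : topologicalType) (f : T -> S) (g : S -> U) :
  continuous f -> continuous g -> continuous (fun t => g (f t)).
Proof. by move=> cf cg x; apply: (@continuous_comp _ _ _ f g); [exact: cf|exact: cg]. Qed.
Lemma cont_pair T (S U : topologicalType) (f : T -> S) (g : T -> U) :
  continuous f -> continuous g -> continuous (fun t => (f t, g t)).
Proof. by move=> cf cg x; apply: cvg_pair; [exact: cf|exact: cg]. Qed.
Lemma cont_comp2 T (S U V : topologicalType) (F : S -> U -> V) (f : T -> S) (g : T -> U) :
  continuous (fun z : S * U => F z.1 z.2) -> continuous f -> continuous g ->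
  continuous (fun t => F (f t) (g t)).
Proof. by move=> cF cf cg; exact: (cont_comp (cont_pair cf cg) cF). Qed.
Lemma cont_fst T (S U : topologicalType) (f : T -> S * U) :
  continuous f -> continuous (fun t => (f t).1).
Proof. by move=> cf; apply: (cont_comp cf) => x; exact: cvg_fst. Qed.
Lemma cont_snd T (S U : topologicalType) (f : T -> S * U) :
  continuous f -> continuous (fun t => (f t).2).
Proof. by move=> cf; apply: (cont_comp cf) => x; exact: cvg_snd. Qed.
Lemma cont_id T : continuous (fun t : T => t).
Proof. by move=> x; exact: cvg_id. Qed.
Lemma cont_exp T (f : T -> R) : continuous f -> continuous (fun t => expR (f t)).
Proof. by move=> cf; apply: (cont_comp cf); exact: continuous_expR. Qed.
Lemma cont_cos T (f : T -> R) : continuous f -> continuous (fun t => cos (f t)).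
Proof. by move=> cf; apply: (cont_comp cf); exact: continuous_cos. Qed.
Lemma cont_sin T (f : T -> R) : continuous f -> continuous (fun t => sin (f t)).
Proof. by move=> cf; apply: (cont_comp cf); exact: continuous_sin. Qed.
Lemma cont_max T (f g : T -> R) : continuous f -> continuous g ->
  continuous (fun t => Num.max (f t) (g t)).
Proof.
move=> cf cg x; apply: (@continuous_max _ _ f g); [exact: cf|exact: cg].
Qed.
Lemma cont_min T (f g : T -> R) : continuous f -> continuous g ->
  continuous (fun t => Num.min (f t) (g t)).
Proof.
move=> cf cg x; apply: (@continuous_min _ _ f g); [exact: cf|exact: cg].
Qed.
End Continuity.

Ltac cont :=
  lazymatch goal with
  | |- continuous (fun _ => ?c) => exact: cont_cst
  | |- continuous (fun t => t) => exact: cont_id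
  | |- continuous (fun t => (@?f t, @?g t)) => apply: (@cont_pair _ _ _ f g); cont
  | |- continuous (fun t => (@?f t).1) => apply: (@cont_fst _ _ _ f); cont
  | |- continuous (fun t => (@?f t).2) => apply: (@cont_snd _ _ _ f); cont
  | |- continuous (fun t => @?f t + @?g t) => apply: (@contD _ _ f g); cont
  | |- continuous (fun t => - @?f t) => apply: (@contN _ _ f); cont
  | |- continuous (fun t => @?f t * @?g t) => apply: (@contM _ _ f g); cont
  | |- continuous (fun t => @?f t ^+ ?n) => apply: (@contX _ _ f n); cont
  | |- continuous (fun t => Num.max (@?f t) (@?g t)) => apply: (@cont_max _ _ f g); cont
  | |- continuous (fun t => Num.min (@?f t) (@?g t)) => apply: (@cont_min _ _ f g); cont
  | |- continuous (fun t => expR (@?f t)) => apply: (@cont_exp _ _ f); cont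
  | |- continuous (fun t => cos (@?f t)) => apply: (@cont_cos _ _ f); cont
  | |- continuous (fun t => sin (@?f t)) => apply: (@cont_sin _ _ f); cont
  | H : continuous (fun z => ?g z.1 z.2) |- continuous (fun t => ?g (@?f t) (@?h t)) =>
      apply: (@cont_comp2 _ _ _ _ g f h H); cont
  | H : continuous ?g |- continuous ?g => exact: H
  | H : continuous ?g |- continuous (fun t => ?g (@?f t)) =>
      apply: (@cont_comp _ _ _ f g _ H); cont
  | |- _ => idtac
  end.

(** * Derivatives of real functions of one variable *)

Section Derivatives.
Context {R : realType}.
Implicit Types f g : R -> R.

Lemma derD f g (x a b : R) : is_derive x 1 f a -> is_derive x 1 g b ->
  is_derive x 1 (fun y => f y + g y) (a + b).
Proof. by move=> df dg; exact: is_deriveD. Qed.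
Lemma derN f (x a : R) : is_derive x 1 f a -> is_derive x 1 (fun y => - f y) (- a).
Proof. by move=> df; exact: is_deriveN. Qed.
Lemma derB f g (x a b : R) : is_derive x 1 f a -> is_derive x 1 g b ->
  is_derive x 1 (fun y => f y - g y) (a - b).
Proof. by move=> df dg; exact: is_deriveB. Qed.
Lemma derM f g (x a b : R) : is_derive x 1 f a -> is_derive x 1 g b ->
  is_derive x 1 (fun y => f y * g y) (f x * b + g x * a).
Proof. by move=> df dg; exact: is_deriveM. Qed.
Lemma der_cst (x c : R) : is_derive x 1 (fun=> c) (0 : R).
Proof. exact: is_derive_cst. Qed.
Lemma der_id (x : R) : is_derive x 1 (fun y : R => y) (1 : R).
Proof. exact: is_derive_id. Qed.
Lemma derZ f (x a c : R) : is_derive x 1 f a -> is_derive x 1 (fun y => c * f y) (c * a).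
Proof. by move=> df; exact: is_deriveZ. Qed.
Lemma der_comp f g (x a b : R) : is_derive (g x) 1 f a -> is_derive x 1 g b ->
  is_derive x 1 (fun y => f (g y)) (a * b).
Proof. by move=> df dg; exact: is_derive1_comp. Qed.
Lemma der_eq f (x a b : R) : is_derive x 1 f a -> a = b -> is_derive x 1 f b.
Proof. by move=> df <-. Qed.
Lemma der_ext f g (x a : R) : (forall y, f y = g y) -> is_derive x 1 f a -> is_derive x 1 g a.
Proof. by move=> /funext ->. Qed.
Lemma der_cont f (df : R -> R) : (forall x : R, is_derive x 1 f (df x)) -> continuous f.
Proof.
move=> d x; apply: differentiable_continuous; apply/derivable1_diffP.
by case: (d x).
Qed.
Lemma mvt f (df : R -> R) (a b : R) : a < b ->
  (forall x : R, a < x -> x < b -> is_derive x 1 f (df x)) -> continuous f ->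
  exists c, [/\ a < c, c < b & f b - f a = df c * (b - a)].
Proof.
move=> ab d cf.
have [c] := @MVT _ f df a b ab (fun x => ltac:(rewrite in_itv /= => /andP[? ?]; exact: d))
  (continuous_subspaceT cf).
by rewrite in_itv /= => /andP[? ?] e; exists c.
Qed.

Lemma der_bound f (df : R -> R) (a b M : R) : a <= b -> continuous f ->
  (forall x : R, a < x -> x < b -> is_derive x 1 f (df x)) ->
  (forall x, a < x -> x < b -> `|df x| <= M) -> `|f b - f a| <= M * (b - a).
Proof.
rewrite le_eqVlt => /predU1P[->|ab] cf d m; first by rewrite !subrr normr0 mulr0.
have [c [? ? ->]] := mvt ab d cf.
by rewrite normrM (@ger0_norm _ (b - a)) ?subr_ge0 ?(ltW ab)// ler_wpM2r ?subr_ge0 ?(ltW ab)// m.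
Qed.

Lemma der0_cst f (a b : R) : a <= b -> continuous f ->
  (forall x : R, a < x -> x < b -> is_derive x 1 f (0 : R)) -> f a = f b.
Proof.
move=> ab cf d; apply/esym/eqP; rewrite -subr_eq0 -normr_le0.
rewrite -(mul0r (b - a)).
by apply: (@der_bound _ (fun=> 0)) => // x _ _; rewrite normr0.
Qed.

Lemma derP f (x d : R) :
  (forall e : R, 0 < e -> \forall h \near (0 : R), `|f (x + h) - f x - h * d| <= e * `|h|) ->
  is_derive x 1 f d.
Proof.
move=> H; have cv : h^-1 *: (f (h + x) - f x) @[h --> (0:R)^'] --> d.
  apply/cvgrPdist_le => e e0; near=> h.
  have h0 : h != 0 by near: h; exact: nbhs_dnbhs_neq.
  have hp : 0 < `|h| by rewrite normr_gt0.
  have : `|f (x + h) - f x - h * d| <= e * `|h|.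
    by near: h; apply: nbhs_dnbhs; exact: H.
  rewrite -ler_pdivrMr// -normfV -normrM; apply: le_trans.
  rewrite distrC (addrC h x) le_eqVlt; apply/orP; left; apply/eqP; congr (`| _ |).
  by rewrite /GRing.scale /=; field.
have E : (fun h : R => h^-1 *: ((f \o shift x) (h *: 1) - f x)) =
     (fun h : R => h^-1 *: (f (h + x) - f x)).
  by apply/funext => h /=; rewrite /GRing.scale /= mulr1.
split; first by rewrite /derivable E; apply/cvg_ex; exists d.
by rewrite /derive E; exact/cvg_lim.
Unshelve. all: end_near. Qed.

Lemma continuousPe (T : topologicalType) (f : T -> R) (x : T) :
  (forall e : R, 0 < e -> \forall y \near x, `|f x - f y| <= e) -> {for x, continuous f}.
Proof. by move=> H; apply/cvgrPdist_le. Qed.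

Lemma continuousPn (T : topologicalType) (f : T -> R) (x : T) :
  {for x, continuous f} -> forall e : R, 0 < e -> \forall y \near x, `|f x - f y| <= e.
Proof. by move=> /cvgrPdist_le. Qed.
End Derivatives.

(** * Primitives of continuous functions and the integral they define *)

Section Primitive.
Context {R : realType}.
Implicit Types f g : R -> R.
Notation mu := (@lebesgue_measure R).

Lemma cont_integrable f (a b : R) : continuous f -> mu.-integrable `[a, b] (EFin \o f).
Proof.
move=> cf; apply: continuous_compact_integrable; first exact: segment_compact.
exact: continuous_subspaceT.
Qed.

Lemma Rintegral_itv_base f (c d x : R) : continuous f -> c <= d -> d <= x ->
  \int[mu]_(t in `[c, x]) f t - \int[mu]_(t in `[c, d]) f t =
  \int[mu]_(t in `[d, x]) f t.
Proof.
move=> cf cd dx; rewrite (@Rintegral_itvB _ f (BLeft c) (BRight x) d) ?bnd_simp//; last exact: cont_integrable.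
apply: Rintegral_itv_obnd_cbnd.
apply: (@integrableS _ _ _ mu `[d, x]) => //; last exact: cont_integrable.
by apply: subset_itvr; rewrite bnd_simp.
Qed.

(** The integral from a base point is a primitive only to the right of that base, so the base [c x]
    moves to the left of both [x] and 0. Subtracting the integral up to 0 makes the value
    independent of the base. *)
Lemma ex_primitive f : continuous f ->
  exists F : R -> R, forall x : R, is_derive x 1 F (f x).
Proof.
move=> cf.
pose I c x := \int[mu]_(t in `[c, x]) f t.
have base (c d x : R) : c <= d -> d <= x -> d <= 0 -> I c x - I c 0 = I d x - I d 0.
  move=> cd dx d0.
  rewrite /I -(Rintegral_itv_base cf cd dx) -(Rintegral_itv_base cf cd d0).
  by rewrite opprB addrA subrK.
pose c (x : R) : R := - (`|x| + 1).
exists (fun x => I (c x) x - I (c x) 0) => x.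
(* One base that lies below [c y] for every [y] within distance 1 of [x]. *)
pose d : R := - (`|x| + 2).
have dx : d < x by have := ler_norm (- x); rewrite normrN /d; lra.
have d0 : d <= 0 by have := normr_ge0 x; rewrite /d; lra.
have xx1 : x < x + 1 by rewrite ltrDl.
have [dI eI] := @continuous_FTC1_closed _ f d x (x + 1) xx1
   (@cont_integrable f d (x + 1) cf) dx (cf x).
have D : is_derive x 1 (I d) (f x).
  split; first exact: dI.
  by rewrite -eI derive1E.
apply: (@near_eq_is_derive _ _ _ (fun y => I d y - I d 0)).
  near=> y.
  have yx : `|x - y| < 1 by near: y; exact: nbhsx_ballx.
  have h1 : `|y| <= `|x| + 1.
    have := ler_normB x (x - y); rewrite opprB addrC subrK; move: yx; lra.
  have h2 := ler_norm (- y); rewrite normrN in h2.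
  apply: base.
  - by rewrite /d /c; lra.
  - by rewrite /c; lra.
  - by rewrite /c; have := normr_ge0 y; lra.
by apply: (der_eq (derB D (der_cst x _))); rewrite subr0.
Unshelve. all: end_near. Qed.

Definition primitive f : R -> R :=
  xget (fun=> 0) [set F | forall x : R, is_derive x 1 F (f x)].

Lemma primitiveP f : continuous f -> forall x : R, is_derive x 1 (primitive f) (f x).
Proof.
move=> /ex_primitive[F HF]; rewrite /primitive.
by case: xgetP => [G _ //|/(_ F)]; tauto.
Qed.

Lemma cont_primitive f : continuous f -> continuous (primitive f).
Proof. by move=> cf; apply: der_cont; exact: primitiveP. Qed.

(* All integrands below are continuous, so that integrals can be handled as
   increments of primitives, without measurability side conditions; [primitive f]
   is only meaningful for continuous [f]. *)
Definition cint f (a b : R) : R := primitive f b - primitive f a.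

Lemma cint_ftc f (F : R -> R) (a b : R) : a <= b -> continuous f -> continuous F ->
  (forall x : R, a < x -> x < b -> is_derive x 1 F (f x)) -> cint f a b = F b - F a.
Proof.
move=> ab cf cF dF; rewrite /cint.
have cpF : continuous (fun x => primitive f x - F x).
  by apply: contB => //; exact: cont_primitive.
have d0 x : a < x -> x < b -> is_derive x 1 (fun x => primitive f x - F x) (0 : R).
  move=> ax xb; apply: (der_eq (derB (primitiveP cf x) (dF _ ax xb))).
  by rewrite subrr.
have E := der0_cst ab cpF d0.
by apply/eqP; rewrite -subr_eq0; apply/eqP; rewrite -[RHS](subrr (primitive f b - F b)) -{2}E; ring.
Qed.

Lemma cint_ftcT f (F : R -> R) (a b : R) : continuous f ->
  (forall x : R, is_derive x 1 F (f x)) -> cint f a b = F b - F a.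
Proof.
move=> cf dF; have cF := der_cont dF.
have [ab|/ltW ba] := leP a b; first exact: cint_ftc.
by rewrite -opprB -(@cint_ftc f F b a)// /cint opprB.
Qed.

Lemma cint_refl f (a : R) : cint f a a = 0. Proof. by rewrite /cint subrr. Qed.

Lemma cint_sym f (a b : R) : cint f a b = - cint f b a.
Proof. by rewrite /cint opprB. Qed.

Lemma cint_chasles f (b a c : R) : cint f a c = cint f a b + cint f b c.
Proof. by rewrite /cint; ring. Qed.

Lemma cint_bound f (a b M : R) : a <= b -> continuous f ->
  (forall x, a < x -> x < b -> `|f x| <= M) -> `|cint f a b| <= M * (b - a).
Proof.
move=> ab cf fM; apply: (@der_bound _ (primitive f) f) => //; first exact: cont_primitive.
by move=> x _ _; exact: primitiveP.
Qed.

Lemma cintD f g (a b : R) : continuous f -> continuous g ->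
  cint (fun x => f x + g x) a b = cint f a b + cint g a b.
Proof.
move=> cf cg; apply: (etrans (@cint_ftcT _ (fun x => primitive f x + primitive g x) a b _ _)); last by rewrite /cint; ring.
- exact: contD.
- by move=> x; apply: derD; exact: primitiveP.
Qed.

Lemma cintZ f (c a b : R) : continuous f -> cint (fun x => c * f x) a b = c * cint f a b.
Proof.
move=> cf; apply: (etrans (@cint_ftcT _ (fun x => c * primitive f x) a b _ _)); last by rewrite /cint; ring.
- by cont.
- by move=> x; apply: derZ; exact: primitiveP.
Qed.

Lemma cintN f (a b : R) : continuous f -> cint (fun x => - f x) a b = - cint f a b.
Proof.
move=> cf; apply: (etrans (@cint_ftcT _ (fun x => - primitive f x) a b _ _)); last by rewrite /cint; ring.
- by cont.
- by move=> x; apply: derN; exact: primitiveP.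
Qed.

Lemma cintB f g (a b : R) : continuous f -> continuous g ->
  cint (fun x => f x - g x) a b = cint f a b - cint g a b.
Proof. by move=> cf cg; rewrite cintD ?cintN//; exact: contN. Qed.

Lemma eq_cint f g (a b : R) : a <= b -> continuous f -> continuous g ->
  (forall x, a < x -> x < b -> f x = g x) -> cint f a b = cint g a b.
Proof.
move=> ab cf cg fg; apply: cint_ftc => //; first exact: cont_primitive.
by move=> x ax xb; rewrite fg//; exact: primitiveP.
Qed.

Lemma cint_cst (c a b : R) : cint (fun=> c) a b = c * (b - a).
Proof.
have d (x : R) : is_derive x 1 (fun y : R => c * y) c.
  by apply: (der_eq (derZ c (der_id x))); rewrite mulr1.
by rewrite (cint_ftcT a b (@cont_cst _ _ _) d) mulrBr.
Qed.

Lemma cint0 (a b : R) : cint (fun=> 0) a b = 0.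
Proof. by rewrite cint_cst mul0r. Qed.

Lemma eq_cint0 f (a b : R) : a <= b -> continuous f ->
  (forall x, a < x -> x < b -> f x = 0) -> cint f a b = 0.
Proof.
move=> ab cf f0; rewrite -(cint0 a b); apply: eq_cint => //; exact: cont_cst.
Qed.

Lemma cint_affine f (k c a b : R) : continuous f ->
  cint (fun y => k * f (k * y + c)) a b = cint f (k * a + c) (k * b + c).
Proof.
move=> cf; apply: (@cint_ftcT _ (fun y => primitive f (k * y + c))); first by cont.
move=> x.
have d : is_derive x (1 : R) (fun y : R => k * y + c) k.
  by apply: (der_eq (derD (derZ k (der_id x)) (der_cst x c))); ring.
by apply: (der_eq (@der_comp _ (primitive f) (fun y : R => k * y + c) x _ k (primitiveP cf _) d)); ring.
Qed.

Lemma cint_shift f (c a b : R) : continuous f ->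
  cint (fun y => f (c + y)) a b = cint f (c + a) (c + b).
Proof.
move=> cf; rewrite -[in RHS](mul1r a) -[in RHS](mul1r b) ![c + _]addrC -cint_affine//.
by apply: (congr1 (fun g => cint g a b)); apply/funext => y; rewrite !mul1r addrC.
Qed.

(** Moves the limits into the integrand, whatever their order, so that continuity with variable
    limits follows from the case of fixed limits. *)
Lemma cint_unit f (a b : R) : continuous f ->
  cint f a b = (b - a) * cint (fun y => f (a + (b - a) * y)) 0 1.
Proof.
move=> cf; rewrite -cintZ; last by cont.
have := @cint_affine f (b - a) a 0 1 cf; rewrite mulr0 add0r mulr1 subrK => <-.
by rewrite (_ : (fun y : R => (b - a) * f ((b - a) * y + a)) = (fun x : R => (b - a) * f (a + (b - a) * x)))//; apply/funext => y; rewrite (addrC a).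
Qed.

Lemma cint_ge0 f (a b : R) : a <= b -> continuous f ->
  (forall x, a < x -> x < b -> 0 <= f x) -> 0 <= cint f a b.
Proof.
rewrite le_eqVlt => /predU1P[->|ab] cf f0; first by rewrite cint_refl.
have [c [? ? e]] := mvt ab (fun x _ _ => primitiveP cf x) (cont_primitive cf).
by rewrite /cint e mulr_ge0 ?f0// subr_ge0 ltW.
Qed.

Lemma der_cint f (a x : R) : continuous f -> is_derive x 1 (cint f a) (f x).
Proof.
move=> cf; apply: (der_eq (derB (primitiveP cf x) (der_cst x (primitive f a)))).
by rewrite subr0.
Qed.
End Primitive.

(** * Integrals depending on a parameter *)

Section Parametric.
Context {R : realType}.

Lemma cont_section (T : topologicalType) (F : T -> R -> R) (t : T) :
  continuous (fun z => F z.1 z.2) -> continuous (F t).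
Proof.
move=> cF y; apply: (@continuous_comp _ _ _ (pair t) (fun z => F z.1 z.2)); last exact: cF.
have h : continuous (fun z : R => (t, z)).
  by apply: cont_pair => z; [exact: cst_continuous|exact: cvg_id].
exact: h.
Qed.

(** Tube lemma: compactness of the segment, in its covering form, makes joint continuity uniform in
    [y]. The parameter space needs no uniform structure, so [T] can be a plane as well as a line. *)
Lemma unif_near (T : topologicalType) (F : T -> R -> R) (a b : R) (t : T) :
  continuous (fun z => F z.1 z.2) ->
  forall e : R, 0 < e -> \forall s \near t, forall y, a <= y -> y <= b -> `|F t y - F s y| <= e.
Proof.
move=> cF e e0.
have /compact_near_coveringP K := @segment_compact R a b.
have FF : Filter (nbhs t) by exact: nbhs_filter.
have := K T (nbhs t) (fun s y => `|F t y - F s y| <= e) FF; move=> KT.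
apply: filterS (KT _) => [s As y ay yb|].
  by apply: As; rewrite /= in_itv /= ay.
move=> y _.
  have e2 : 0 < e / 2 by rewrite divr_gt0.
  have c1 := continuousPn (cF (t, y)) e2.
  have c2 : {for y, continuous (fun z => F t z)}.
    exact: cont_section.
  have {}c2 := continuousPn c2 e2.
  have c3 : \forall z \near y & s \near t, `|F t y - F s z| <= e / 2.
    move: c1 => [[A B] /= [nA nB] AB].
    exists (B, A) => //= -[u v] /= [Bu Av]; exact: (AB (v, u)).
  move: c3 => [[A B] /= [nA nB] AB].
  exists (A `&` [set z | `|F t y - F t z| <= e / 2], B) => /=.
    by split => //; exact: filterI.
  move=> -[z s] /= [[Az h2] Bs]; have h1 := AB (z, s) (conj Az Bs).
  rewrite /= in h1; rewrite (_ : _ - _ = (F t y - F s z) - (F t y - F t z)); last by ring.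
  by rewrite (le_trans (ler_normB _ _))// (splitr e) lerD.
Qed.

Lemma cont_cint0 (T : topologicalType) (F : T -> R -> R) (a b : R) : a <= b ->
  continuous (fun z => F z.1 z.2) -> continuous (fun t => cint (F t) a b).
Proof.
move=> ab cF t; apply: continuousPe => e e0.
have M0 : 0 < b - a + 1 by rewrite ltr_wpDl ?subr_ge0.
have := unif_near a b t cF (divr_gt0 e0 M0).
apply: filterS => s H; rewrite -cintB; [|exact: cont_section..].
apply: (le_trans (cint_bound ab _ (fun x ax xb => H x (ltW ax) (ltW xb)))).
  by apply: contB; exact: cont_section.
rewrite -mulrA ler_piMr ?(ltW e0)// mulrC ler_pdivrMr// mul1r; lra.
Qed.

Lemma cont_cint (T : topologicalType) (F : T -> R -> R) (u v : T -> R) :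
  continuous (fun z => F z.1 z.2) -> continuous u -> continuous v ->
  continuous (fun t => cint (F t) (u t) (v t)).
Proof.
move=> cF cu cv.
rewrite (_ : (fun t => _) = (fun t => (v t - u t) * cint (fun y => F t (u t + (v t - u t) * y)) 0 1)); last first.
  by apply/funext => t; rewrite cint_unit//; exact: cont_section.
have : continuous (fun t => cint (fun y => F t (u t + (v t - u t) * y)) 0 1).
  by apply: cont_cint0 => //; cont.
by move=> h; cont.
Qed.

(** The mean value inequality for [F t y - t * F' x y], whose derivative in [t] is small uniformly
    in [y] by [unif_near]. *)
Lemma der_unif (F F' : R -> R -> R) (a b x : R) :
  continuous (fun z => F' z.1 z.2) ->
  (forall x y : R, is_derive x 1 (F ^~ y) (F' x y)) ->
  forall e : R, 0 < e -> \forall h \near (0 : R), forall y, a <= y -> y <= b ->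
    `|F (x + h) y - F x y - h * F' x y| <= e * `|h|.
Proof.
move=> cF' dF e e0.
have := unif_near a b x cF' e0 => /nbhs_ballP[d /= d0 H].
near=> h.
have hd : `|h| < d by near: h; exact: (@nbhs0_lt R R).
move=> y ay yb.
have D (t : R) : is_derive t 1 (fun t => F t y - t * F' x y) (F' t y - F' x y).
  by apply: (der_eq (derB (dF t y) (derM (der_id t) (der_cst t (F' x y))))); ring.
have cD := der_cont D.
have B t : `|x - t| <= `|h| -> `|F' t y - F' x y| <= e.
  by move=> xt; rewrite distrC; apply: H => //; rewrite /ball /=; exact: le_lt_trans hd.
rewrite (_ : _ - _ = (F (x + h) y - (x + h) * F' x y) - (F x y - x * F' x y)); last by ring.
have [h0|/ltW h0] := leP 0 h.
  have xh : x <= x + h by rewrite lerDl.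
  apply: (le_trans (@der_bound _ (fun t => F t y - t * F' x y) _ x (x + h) e xh cD (fun t _ _ => D t) _)).
    move=> t xt th; apply: B; rewrite (@ltr0_norm _ (x - t)) ?subr_lt0// (ger0_norm h0); lra.
  by rewrite ger0_norm// addrC addKr.
have xh : x + h <= x by rewrite gerDl.
rewrite distrC; apply: (le_trans (@der_bound _ (fun t => F t y - t * F' x y) _ (x + h) x e xh cD (fun t _ _ => D t) _)).
  move=> t xt th; apply: B; rewrite (@gtr0_norm _ (x - t)) ?subr_gt0// (ler0_norm h0); lra.
by rewrite ler0_norm// opprD addNKr.
Unshelve. all: end_near. Qed.

Lemma der_cint_param (F F' : R -> R -> R) (a b x : R) : a <= b ->
  continuous (fun z => F z.1 z.2) -> continuous (fun z => F' z.1 z.2) ->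
  (forall x y : R, is_derive x 1 (F ^~ y) (F' x y)) ->
  is_derive x 1 (fun x => cint (F x) a b) (cint (F' x) a b).
Proof.
move=> ab cF cF' dF; apply: derP => e e0.
have M0 : 0 < b - a + 1 by rewrite ltr_wpDl ?subr_ge0.
have := der_unif a b x cF' dF (divr_gt0 e0 M0); apply: filterS => h H.
have cs t : continuous (F t) by exact: cont_section.
have cs' t : continuous (F' t) by exact: cont_section.
rewrite -cintZ// -cintB// -cintB; [|by cont..].
apply: (le_trans (cint_bound ab _ (fun x ax xb => H x (ltW ax) (ltW xb)))).
  by cont.
rewrite mulrAC ler_wpM2r// -mulrA ler_piMr ?(ltW e0)// mulrC ler_pdivrMr// mul1r; lra.
Qed.

(** Relative to a fixed base [c] below [x], only the integral from [c] to the moving point has a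
    variable limit. Its increment splits into a parametric part over [[c, x]], bounded by
    [der_unif], and a thin strip from [x] to [x + h], where [F] is close to [F x x]. *)
Lemma der_cint_leibniz (F F' : R -> R -> R) (b x : R) :
  continuous (fun z => F z.1 z.2) -> continuous (fun z => F' z.1 z.2) ->
  (forall x y : R, is_derive x 1 (F ^~ y) (F' x y)) ->
  is_derive x 1 (fun x => cint (F x) x b) (cint (F' x) x b - F x x).
Proof.
move=> cF cF' dF.
have cs t : continuous (F t) by exact: cont_section.
have cs' t : continuous (F' t) by exact: cont_section.
pose c := x - 1.
have E : (fun x => cint (F x) x b) = (fun y => cint (F y) c b - cint (F y) c y).
  by apply/funext => y; rewrite (@cint_chasles _ _ y c b) addrC addKr.
rewrite E (_ : cint _ x b - _ = cint (F' x) c b - (cint (F' x) c x + F x x)); last first.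
  by rewrite (@cint_chasles _ _ x c b); ring.
have D0 (u v : R) : is_derive x 1 (fun x => cint (F x) u v) (cint (F' x) u v).
  have [uv|/ltW vu] := leP u v; first exact: der_cint_param.
  rewrite cint_sym; apply: (@der_ext _ (fun y => - cint (F y) v u)).
    by move=> y; rewrite -cint_sym.
  by apply: derN; exact: der_cint_param.
apply: (@derB _ (fun y => cint (F y) c b) (fun y => cint (F y) c y) x _ _ (D0 c b)).
apply: derP => e e0.
have e2 : 0 < e / 2 by rewrite divr_gt0.
have M0 : 0 < x - c + 1 by rewrite /c; lra.
have H1 := der_unif c x x cF' dF (divr_gt0 e2 M0).
have H2 := continuousPn (cF (x, x)) e2.
near=> h.
have K1 : forall y, c <= y -> y <= x -> `|F (x + h) y - F x y - h * F' x y| <= e / 2 / (x - c + 1) * `|h|.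
  by near: h; exact: H1.
have L1 : `|cint (F (x + h)) c x - cint (F x) c x - h * cint (F' x) c x| <= e / 2 * `|h|.
  rewrite -cintZ// -cintB// -cintB; [|by cont..].
  have cx : c <= x by rewrite /c; lra.
  apply: (le_trans (cint_bound cx _ (fun x ax xb => K1 x (ltW ax) (ltW xb)))); first by cont.
  rewrite mulrAC ler_wpM2r//; move: (e / 2) e2 => r r0.
  rewrite -mulrA ler_piMr ?(ltW r0)// mulrC ler_pdivrMr// mul1r; lra.
have K2 : forall y, `|x - y| <= `|h| -> `|F x x - F (x + h) y| <= e / 2.
  near: h; move: H2 => [[A B] /= [nA nB] AB].
  move: nA nB => /nbhs_ballP[d1 /= d10 A1] /nbhs_ballP[d2 /= d20 B2].
  near=> h => y xy; apply: (AB (x + h, y)); split => /=.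
    apply: A1; rewrite /ball /= opprD addNKr normrN.
    by near: h; exact: (@nbhs0_lt R R).
  apply: B2; rewrite /ball /=; apply: (le_lt_trans xy).
  by near: h; exact: (@nbhs0_lt R R).
have L2 : `|cint (F (x + h)) x (x + h) - h * F x x| <= e / 2 * `|h|.
  have -> : h * F x x = cint (fun=> F x x) x (x + h).
    by rewrite cint_cst (addrC x) addrK mulrC.
  rewrite -cintB //; last exact: cont_cst.
  have [h0|/ltW h0] := leP 0 h.
    have xh : x <= x + h by rewrite lerDl.
    apply: (le_trans (@cint_bound _ _ _ _ (e / 2) xh _ _)); first by cont.
      move=> y xy yh; rewrite distrC; apply: K2; rewrite (@ltr0_norm _ (x - y)) ?subr_lt0// (ger0_norm h0); lra.
    by rewrite ger0_norm// addrC addKr.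
  have xh : x + h <= x by rewrite gerDl.
  rewrite cint_sym normrN; apply: (le_trans (@cint_bound _ _ _ _ (e / 2) xh _ _)); first by cont.
    move=> y xy yh; rewrite distrC; apply: K2; rewrite (@gtr0_norm _ (x - y)) ?subr_gt0// (ler0_norm h0); lra.
  by rewrite ler0_norm// opprD addNKr.
rewrite (@cint_chasles _ _ x c (x + h)).
rewrite (_ : _ - _ = (cint (F (x + h)) c x - cint (F x) c x - h * cint (F' x) c x) +
  (cint (F (x + h)) x (x + h) - h * F x x)); last by ring.
by rewrite (le_trans (ler_normD _ _))// (splitr e) mulrDl lerD.
Unshelve. all: end_near. Qed.

(** As functions of the upper limit [b], both sides vanish at [a] and have the same derivative. *)
Lemma cint_fubini (F : R -> R -> R) (a b c d : R) : a <= b -> c <= d ->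
  continuous (fun z => F z.1 z.2) ->
  cint (fun x => cint (F x) c d) a b = cint (fun y => cint (F ^~ y) a b) c d.
Proof.
move=> ab cd cF.
have cF' : continuous (fun z => F z.2 z.1) by cont.
have cs x : continuous (F x) by exact: cont_section.
have cs' y : continuous (F ^~ y) by exact: (@cont_section _ (fun y x => F x y)).
apply: (etrans (@cint_ftc _ _ (fun t => cint (fun y => cint (F ^~ y) a t) c d) a b ab _ _ _)); last first.
- rewrite [X in _ - X](_ : _ = 0) ?subr0//.
  rewrite (_ : (fun y => _) = fun=> 0) ?cint0//.
  by apply/funext => y; rewrite cint_refl.
- move=> x _ _; apply: (@der_cint_param (fun t y => cint (F ^~ y) a t) F) => //.
    by apply: (@cont_cint _ (fun z x => F x z.2) (fun=> a) (fun z => z.1)); cont.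
  by move=> t y; exact: der_cint.
- apply: cont_cint0 => //.
  by apply: (@cont_cint _ (fun z x => F x z.2) (fun=> a) (fun z => z.1)); cont.
- exact: cont_cint0.
Qed.
End Parametric.

(** * Recovering a potential from a small kernel *)

Section UniformLimits.
Context {R : realType}.

(** Adding the partial sums [s n] makes the sequence nondecreasing at each point, so the limit is a
    supremum minus [L]. This works on a bare type [S]. *)
Lemma uniform_cauchy (S : Type) (fn : nat -> S -> R) (eps : nat -> R) (E : R) :
  (forall n, 0 <= eps n) -> (forall n, \sum_(i < n) eps i <= E) ->
  (forall n x, `|fn n.+1 x - fn n x| <= eps n) ->
  exists f : S -> R, forall e : R, 0 < e ->
    exists n0, forall n, (n0 <= n)%N -> forall x, `|f x - fn n x| <= e.
Proof.
move=> eps0 epsE fnE.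
pose s n := \sum_(i < n) eps i.
have sS n : s n.+1 = s n + eps n by rewrite /s big_ord_recr.
have smono n m : (n <= m)%N -> s n <= s m.
  move=> /subnK <-; elim: (m - n)%N => [|k IH]; first by rewrite add0n.
  by rewrite addSn sS; have := eps0 (k + n)%N; lra.
have diff x n m : (n <= m)%N -> `|fn m x - fn n x| <= s m - s n.
  move=> /subnK <-; elim: (m - n)%N => [|k IH]; first by rewrite add0n !subrr normr0.
  rewrite addSn sS -(subrKA (fn (k + n)%N x)) (le_trans (ler_normD _ _))//.
  by have := fnE (k + n)%N x; lra.
have supL : has_sup (range s).
  by split; [exists (s 0%N); exists 0%N | exists E => _ [n _ <-]; exact: epsE].
pose L := sup (range s).
have sL n : s n <= L by apply: sup_upper_bound => //; exists n.
pose U x := range (fun n => fn n x + s n).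
have bU x n m : fn m x + s m <= fn n x - s n + 2 * L.
  have [mn|/ltnW nm] := leqP m n.
    by have := diff x _ _ mn; have := sL n; have := smono _ _ mn; rewrite ler_norml => ? ? /andP[]; lra.
  by have := diff x _ _ nm; have := sL m; have := smono _ _ nm; rewrite ler_norml => ? ? /andP[]; lra.
have supU x : has_sup (U x).
  split; first by exists (fn 0%N x + s 0%N); exists 0%N.
  by exists (fn 0%N x - s 0%N + 2 * L) => _ [n _ <-]; exact: bU.
exists (fun x => sup (U x) - L) => e e0.
have [_ [n0 _ <-] Le] := sup_adherent e0 supL.
exists n0 => n n0n x.
have h1 : fn n x + s n <= sup (U x) by apply: sup_upper_bound => //; exists n.
have h2 : sup (U x) <= fn n x - s n + 2 * L.
  by apply: ge_sup; [exact: (proj1 (supU x))|move=> _ [m _ <-]; exact: bU].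
have := smono _ _ n0n; have := sL n; rewrite -/L in Le => h3 h4.
by rewrite ler_norml; apply/andP; split; lra.
Qed.

Lemma cont_unif_lim (T : topologicalType) (f : T -> R) :
  (forall e : R, 0 < e -> exists2 g, continuous g & forall x, `|f x - g x| <= e) ->
  continuous f.
Proof.
move=> H x; apply: continuousPe => e e0.
have e3 : 0 < e / 3 by rewrite divr_gt0.
have [g cg fg] := H _ e3.
have := continuousPn (cg x) e3; apply: filterS => y gxy.
have -> : f x - f y = (f x - g x) + (g x - g y) - (f y - g y) by ring.
have := fg x; have := fg y; have := ler_normB (f x - g x + (g x - g y)) (f y - g y).
by have := ler_normD (f x - g x) (g x - g y); lra.
Qed.

Lemma geometric_sum_le (c : R) n : 0 <= c -> c < 1 -> \sum_(i < n) c ^+ i <= (1 - c)^-1.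
Proof.
move=> c0 c1; have c10 : 0 < 1 - c by rewrite subr_gt0.
rewrite -[leRHS]mul1r ler_pdivlMr// mulrC -opprB mulNr -subrX1 opprB gerBl.
by rewrite exprn_ge0.
Qed.

(** Banach's fixed point theorem in a class [G] closed under uniform limits. The domain is a bare
    type because it will be the disjoint union [R + R * R], which carries a potential and a kernel
    at once. *)
Lemma uniform_contraction (S : Type) (T : (S -> R) -> S -> R) (G : (S -> R) -> Prop)
    (f0 : S -> R) (c N : R) :
  0 <= c -> c < 1 ->
  G f0 -> (forall f, G f -> G (T f)) ->
  (forall f, (forall e, 0 < e -> exists2 g, G g & forall x, `|f x - g x| <= e) -> G f) ->
  (forall f g (M : R), G f -> G g -> (forall x, `|f x - g x| <= M) ->
     forall x, `|T f x - T g x| <= c * M) ->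
  (forall x, `|T f0 x - f0 x| <= N) ->
  exists2 f, G f & forall x, T f x = f x.
Proof.
move=> c0 c1 Gf0 GT Gcl contr TN.
pose fn n := iter n T f0.
have Gfn n : G (fn n) by elim: n => // n; exact: GT.
(* On an empty [S] the bound [N] could be negative, so that case is settled apart. *)
have [x0|noS] := pselect (exists x : S, True); last first.
  by exists f0 => // x; case: noS; exists x.
have N0 : 0 <= N by case: x0 => x _; exact: le_trans (TN x).
have fnS n x : `|fn n.+1 x - fn n x| <= N * c ^+ n.
  elim: n x => [|n IH] x; first by rewrite expr0 mulr1; exact: TN.
  rewrite exprSr mulrA mulrC.
  exact: (contr (fn n.+1) (fn n) _ (Gfn _) (Gfn _) IH x).
have sumN n : \sum_(i < n) N * c ^+ i <= N / (1 - c).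
  by rewrite -mulr_sumr ler_wpM2l// geometric_sum_le.
have [f Hf] := uniform_cauchy (fun n => mulr_ge0 N0 (exprn_ge0 n c0)) sumN fnS.
have Gf : G f.
  by apply: Gcl => e e0; have [n0 /(_ n0 (leqnn _)) h] := Hf e e0; exists (fn n0).
exists f => // x; apply/eqP; rewrite -subr_eq0 -normr_le0; apply/ler_addgt0Pr => e e0.
rewrite add0r; have e2 : 0 < e / 2 by rewrite divr_gt0.
have [n0 Hn] := Hf _ e2.
have h1 := Hn n0.+1 (leqnSn _) x.
have h2 := contr _ _ _ Gf (Gfn n0) (Hn n0 (leqnn _)) x.
have h3 : c * (e / 2) <= e / 2 by rewrite ler_piMl ?ltW.
have -> : T f x - f x = (T f x - T (fn n0) x) - (f x - fn n0.+1 x) by rewrite /fn /=; ring.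
have := ler_normB (T f x - T (fn n0) x) (f x - fn n0.+1 x); lra.
Qed.
End UniformLimits.

Lemma potential_bound (R : realType) (y I1 I2 K c a delta : R) :
  0 <= delta -> `|y| <= delta -> K * a <= 4^-1 * delta ->
  `|I1| <= K * c -> `|I2| <= K * (a - c) -> `|y - 2 * I1 + 2 * I2| <= 2 * delta.
Proof.
move=> d0 hy hK hI1 hI2; have := ler_normD (y - 2 * I1) (2 * I2).
by have := ler_normB y (2 * I1); rewrite !normrM !(@ger0_norm _ 2)//; lra.
Qed.

(** * The fixed point problem for potential and kernel *)

Section InverseProblem.
Context {R : realType} (a delta : R) (p : R -> R).
Context (a0 : 0 < a) (delta0 : 0 <= delta) (small : a ^+ 2 * delta <= 16^-1)
  (cp : continuous p) (p_le : forall x, `|p x| <= delta).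

(** Freezing the arguments outside [[0, a]] makes all bounds and continuity statements global, so
    that the sup norm is taken over the whole line and plane. In the region v > u, where x = u - v
    is negative, the potential takes its frozen value at 0. *)
Definition clamp (x : R) : R := Num.max 0 (Num.min x a).

Lemma clamp_ge0 x : 0 <= clamp x. Proof. by rewrite le_max lexx. Qed.
Lemma clamp_le x : clamp x <= a.
Proof. by rewrite ge_max ltW//= ge_min lexx orbT. Qed.
Lemma clamp_id x : 0 <= x -> x <= a -> clamp x = x.
Proof. by move=> x0 xa; rewrite /clamp min_l// max_r. Qed.
Lemma clamp_ge x : a <= x -> clamp x = a.
Proof. by move=> ax; rewrite /clamp min_r// max_r ?ltW. Qed.
Lemma cont_clamp : continuous clamp.
Proof. by rewrite /clamp; cont. Qed.

(* In the characteristic coordinates u = (t + x) / 2, v = (t - x) / 2, the kernel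
   K(x, t) = H(u, v) of the Jost solution e^{ikx} + int_x^oo K(x, t) e^{ikt} dt
   satisfies [d_u H = - hker q H] and vanishes for u >= a. *)
Definition hker (q : R -> R) (H : R -> R -> R) (s v : R) : R :=
  2^-1 * q s + cint (fun r => q (s - r) * H s r) 0 v.

Definition kernelmap (q : R -> R) (H : R -> R -> R) (u v : R) : R :=
  cint (fun s => hker q H s (clamp v)) (clamp u) a.

(* Obtained by differentiating H(u, u) = A(u) / 2 with p = - A'. *)
Definition potentialmap (q : R -> R) (H : R -> R -> R) (x : R) : R :=
  p (clamp x) - 2 * cint (fun r => q (clamp x - r) * H (clamp x) r) 0 (clamp x)
  + 2 * cint (fun s => q (s - clamp x) * H s (clamp x)) (clamp x) a.

Lemma cont_hker q H : continuous q -> continuous (fun z => H z.1 z.2) ->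
  continuous (fun z => hker q H z.1 z.2).
Proof.
move=> cq cH; rewrite /hker; apply: contD; first by cont.
apply: (@cont_cint _ _ (fun z r => q (z.1 - r) * H z.1 r) (fun=> 0) (fun z => z.2)); cont.
Qed.

Lemma cont_kernelmap q H : continuous q -> continuous (fun z => H z.1 z.2) ->
  continuous (fun z => kernelmap q H z.1 z.2).
Proof.
move=> cq cH; have cg := cont_hker cq cH; have cc := cont_clamp.
apply: (@cont_cint _ _ (fun z s => hker q H s (clamp z.2)) (fun z => clamp z.1) (fun=> a)); cont.
Qed.

Lemma cont_potentialmap q H : continuous q -> continuous (fun z => H z.1 z.2) ->
  continuous (potentialmap q H).
Proof.
move=> cq cH; have cc := cont_clamp; rewrite /potentialmap.
apply: contD; [apply: contB; first by cont|]; apply: contM; try exact: cont_cst.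
- apply: (@cont_cint _ _ (fun x r => q (clamp x - r) * H (clamp x) r) (fun=> 0) clamp); cont.
- apply: (@cont_cint _ _ (fun x s => q (s - clamp x) * H s (clamp x)) clamp (fun=> a)); cont.
Qed.

(* The potential is stored multiplied by [a], so that both components have size
   O(a delta) and the map contracts in the plain sup norm. *)
Definition fixpoint_map (f : R + R * R -> R) : R + R * R -> R := fun z =>
  let q x := a^-1 * f (inl x) in let H u v := f (inr (u, v)) in
  match z with
  | inl x => a * potentialmap q H x
  | inr (u, v) => kernelmap q H u v
  end.

Definition admissible (f : R + R * R -> R) : Prop :=
  [/\ forall z, `|f z| <= 2 * (a * delta), continuous (fun x => f (inl x))
    & continuous (fun z => f (inr z))].

Lemma cint_clamp_bound (f : R -> R) (M u : R) : continuous f -> 0 <= M ->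
  (forall x, `|f x| <= M) -> `|cint f 0 (clamp u)| <= M * clamp u /\
  `|cint f (clamp u) a| <= M * (a - clamp u).
Proof.
move=> cf M0 fM; split.
  by have := @cint_bound _ f 0 (clamp u) M (clamp_ge0 u) cf (fun x _ _ => fM x); rewrite subr0.
by apply: cint_bound => //; exact: clamp_le.
Qed.

(** In the ball, q is at most 2 delta and H at most 2 a delta, so an integral of q H over a length
    at most a is at most 4 a^2 delta^2, hence at most delta / 4 by [small]. The new q is then at
    most 3/2 delta and the new H at most 5/4 a delta, within the radius. *)
Lemma admissible_fixpoint_map f : admissible f -> admissible (fixpoint_map f).
Proof.
move=> [fB cf1 cf2].
pose q x := a^-1 * f (inl x); pose H u v := f (inr (u, v)).
have cq : continuous q by rewrite /q; cont.
have cH : continuous (fun z => H z.1 z.2).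
  by rewrite /H (_ : (fun z => _) = (fun z => f (inr z)))//; apply/funext => -[].
have qB x : `|q x| <= 2 * delta.
  rewrite /q normrM (gtr0_norm (x := a^-1)) ?invr_gt0// ler_pdivrMl//.
  by have := fB (inl x); lra.
have HB u v : `|H u v| <= 2 * (a * delta) by exact: fB.
have qHB x u v : `|q x * H u v| <= 4 * a * delta ^+ 2.
  rewrite normrM (_ : 4 * _ * _ = (2 * delta) * (2 * (a * delta))); last by ring.
  by rewrite ler_pM.
have K0 : 0 <= 4 * a * delta ^+ 2 by rewrite !mulr_ge0// ?ltW.
have Ka : 4 * a * delta ^+ 2 * a <= 4^-1 * delta.
  by have := ler_wpM2r delta0 small; lra.
have gB s v : `|hker q H s (clamp v)| <= (5 / 4) * delta.
  have [|h _] := @cint_clamp_bound (fun r => q (s - r) * H s r) _ v _ K0 (fun r => qHB _ _ _).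
    by cont.
  have := ler_normD (2^-1 * q s) (cint (fun r => q (s - r) * H s r) 0 (clamp v)).
  rewrite normrM ger0_norm// => /le_trans; apply.
  have := qB s; have := ler_wpM2l K0 (clamp_le v); lra.
have cg := cont_hker cq cH.
split.
- move=> [x|[u v]] /=; rewrite -/q -/H.
    rewrite normrM (gtr0_norm a0) mulrCA ler_wpM2l ?(ltW a0)//.
    have [|h1 _] := @cint_clamp_bound (fun r => q (clamp x - r) * H (clamp x) r) _ x _ K0 (fun r => qHB _ _ _).
      by cont.
    have [|_ h2] := @cint_clamp_bound (fun s => q (s - clamp x) * H s (clamp x)) _ x _ K0 (fun r => qHB _ _ _).
      by cont.
    exact: (potential_bound delta0 (p_le _) Ka h1 h2).
  have [||_ h] := @cint_clamp_bound (fun s => hker q H s (clamp v)) ((5 / 4) * delta) u _ _ (fun s => gB s v).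
  + by cont.
  + by rewrite mulr_ge0.
  apply: (le_trans h); have := ler_wpM2l delta0 (clamp_ge0 u); have := mulr_ge0 (ltW a0) delta0.
  lra.
- exact: (contM (@cont_cst _ _ a) (cont_potentialmap cq cH)).
- rewrite (_ : (fun z => _) = (fun z => kernelmap q H z.1 z.2)); first exact: cont_kernelmap.
  by apply/funext => -[].
Qed.

(** The linear term [2^-1 * q s] of [hker] is not made small by [small]: with q stored multiplied by
    [a], it contributes N / 2 to the kernel. The quadratic terms add N / 4, which gives 3/4. In the
    potential component two integrals of total length [a], each doubled, give N / 2. *)
Lemma fixpoint_map_contract f g (N : R) : admissible f -> admissible g -> (forall z, `|f z - g z| <= N) ->
  forall z, `|fixpoint_map f z - fixpoint_map g z| <= (3 / 4) * N.
Proof.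
move=> [fB cf1 cf2] [gB cg1 cg2] fg.
have N0 : 0 <= N := le_trans (normr_ge0 _) (fg (inl 0)).
pose q x := a^-1 * f (inl x); pose H u v := f (inr (u, v)).
pose q' x := a^-1 * g (inl x); pose H' u v := g (inr (u, v)).
have cq : continuous q by rewrite /q; cont.
have cq' : continuous q' by rewrite /q'; cont.
have cH : continuous (fun z => H z.1 z.2).
  by rewrite /H (_ : (fun z => _) = (fun z => f (inr z)))//; apply/funext => -[].
have cH' : continuous (fun z => H' z.1 z.2).
  by rewrite /H' (_ : (fun z => _) = (fun z => g (inr z)))//; apply/funext => -[].
have ai : 0 < a^-1 by rewrite invr_gt0.
have qB x : `|q' x| <= 2 * delta.
  by rewrite /q' normrM (gtr0_norm ai) ler_pdivrMl//; have := gB (inl x); lra.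
have qq x : `|q x - q' x| <= a^-1 * N.
  by rewrite /q /q' -mulrBr normrM (gtr0_norm ai) ler_wpM2l ?(ltW ai).
have HB u v : `|H u v| <= 2 * (a * delta) by exact: fB.
have HH u v : `|H u v - H' u v| <= N by exact: fg.
have qHB x u v : `|q x * H u v - q' x * H' u v| <= 4 * delta * N.
  have -> : q x * H u v - q' x * H' u v = (q x - q' x) * H u v + q' x * (H u v - H' u v) by ring.
  rewrite (le_trans (ler_normD _ _))//.
  have := ler_pM (normr_ge0 _) (normr_ge0 _) (qq x) (HB u v); rewrite -normrM.
  have := ler_pM (normr_ge0 _) (normr_ge0 _) (qB x) (HH u v); rewrite -normrM.
  have -> : a^-1 * N * (2 * (a * delta)) = 2 * delta * N by field; rewrite gt_eqF.
  lra.
have K0 : 0 <= 4 * delta * N by rewrite !mulr_ge0.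
have aK : a * (4 * delta * N * a) <= 4^-1 * N.
  by have := ler_wpM2r N0 small; lra.
have Ka : 4 * delta * N * a <= a^-1 * (4^-1 * N) by rewrite ler_pdivlMl.
have cg := cont_hker cq cH; have cg' := cont_hker cq' cH'.
have gkB s v : `|hker q H s (clamp v) - hker q' H' s (clamp v)| <= a^-1 * ((3 / 4) * N).
  have c1 : continuous (fun r => q (s - r) * H s r) by cont.
  have c2 : continuous (fun r => q' (s - r) * H' s r) by cont.
  have [|h _] := @cint_clamp_bound (fun r => q (s - r) * H s r - q' (s - r) * H' s r) _ v _ K0 (fun r => qHB _ _ _).
    exact: contB.
  rewrite cintB// in h.
  rewrite /hker; set I1 := cint _ _ _ in h *; set I2 := cint _ _ _ in h *.
  have -> : 2^-1 * q s + I1 - (2^-1 * q' s + I2) = 2^-1 * (q s - q' s) + (I1 - I2) by ring.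
  rewrite (le_trans (ler_normD _ _))// normrM ger0_norm//.
  have := qq s; have := ler_wpM2l K0 (clamp_le v); lra.
move=> [x|[u v]] /=; rewrite -/q -/H -/q' -/H'.
  have c1 : continuous (fun r => q (clamp x - r) * H (clamp x) r) by cont.
  have c1' : continuous (fun r => q' (clamp x - r) * H' (clamp x) r) by cont.
  have c2 : continuous (fun s => q (s - clamp x) * H s (clamp x)) by cont.
  have c2' : continuous (fun s => q' (s - clamp x) * H' s (clamp x)) by cont.
  have [|h1 _] := @cint_clamp_bound (fun r => q (clamp x - r) * H (clamp x) r - q' (clamp x - r) * H' (clamp x) r) _ x _ K0 (fun r => qHB _ _ _).
    exact: contB.
  have [|_ h2] := @cint_clamp_bound (fun s => q (s - clamp x) * H s (clamp x) - q' (s - clamp x) * H' s (clamp x)) _ x _ K0 (fun r => qHB _ _ _).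
    exact: contB.
  rewrite !cintB// in h1 h2.
  rewrite /potentialmap -mulrBr normrM (gtr0_norm a0) -ler_pdivlMl//.
  set I1 := cint _ 0 _ in h1 *; set I1' := cint _ 0 _ in h1 *.
  set I2 := cint _ _ a in h2 *; set I2' := cint _ _ a in h2 *.
  have -> : p (clamp x) - 2 * I1 + 2 * I2 - (p (clamp x) - 2 * I1' + 2 * I2') =
    2 * (I2 - I2') - 2 * (I1 - I1') by ring.
  rewrite (le_trans (ler_normB _ _))// !normrM !(@ger0_norm _ 2)//.
  have := mulr_ge0 (ltW ai) N0; lra.
have [||_ h] := @cint_clamp_bound (fun s => hker q H s (clamp v) - hker q' H' s (clamp v)) (a^-1 * ((3 / 4) * N)) u _ _ (fun s => gkB s v).
- by apply: contB; cont.
- by rewrite mulr_ge0 ?(ltW ai)// mulr_ge0.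
rewrite cintB in h; [|by cont|by cont].
rewrite /kernelmap; apply: (le_trans h).
apply: (@le_trans _ _ (a^-1 * (3 / 4 * N) * a)).
  by rewrite ler_wpM2l ?mulr_ge0 ?(ltW ai)//; have := clamp_ge0 u; lra.
by rewrite mulrAC mulVf ?mul1r// gt_eqF.
Qed.

Lemma inverse_fixpoint : exists (q : R -> R) (H : R -> R -> R),
  [/\ continuous q, continuous (fun z => H z.1 z.2),
     forall x, q x = potentialmap q H x & forall u v, H u v = kernelmap q H u v].
Proof.
have [|||||||f [fB cf1 cf2] ff] := @uniform_contraction R _ fixpoint_map admissible (fun=> 0) (3 / 4) (2 * (a * delta)).
- by [].
- lra.
- by split=> [z||]; rewrite ?normr0 ?mulr_ge0 ?(ltW a0)//; exact: cont_cst.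
- exact: admissible_fixpoint_map.
- move=> f Hf; split.
  + move=> z; apply/ler_addgt0Pr => e e0; have [g [gB _ _] /(_ z) fg] := Hf e e0.
    have := gB z; have := ler_normD (g z) (f z - g z); rewrite addrC subrK; lra.
  + apply: cont_unif_lim => e e0; have [g [_ c1 _] fg] := Hf e e0.
    by exists (fun x => g (inl x)).
  + apply: cont_unif_lim => e e0; have [g [_ _ c2] fg] := Hf e e0.
    by exists (fun x => g (inr x)).
- exact: fixpoint_map_contract.
- have g0 : admissible (fun=> 0).
    by split=> [z||]; rewrite ?normr0 ?mulr_ge0 ?(ltW a0)//; exact: cont_cst.
  by case: (admissible_fixpoint_map g0) => h _ _ x; rewrite subr0.
exists (fun x => a^-1 * f (inl x)), (fun u v => f (inr (u, v))); split.
- by cont.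
- by rewrite (_ : (fun z => _) = (fun z => f (inr z)))//; apply/funext => -[].
- move=> x; rewrite -[in LHS](ff (inl x)) /= mulKf// gt_eqF//.
- by move=> u v; rewrite -[in LHS](ff (inr (u, v))).
Qed.
End InverseProblem.

Lemma small_inverse (R : realType) (a delta : R) (A dA : R -> R) :
  0 < a -> 0 <= delta -> a ^+ 2 * delta <= 16^-1 ->
  continuous dA -> (forall x : R, is_derive x 1 A (dA x)) -> (forall x, `|dA x| <= delta) ->
  A a = 0 -> dA a = 0 ->
  exists (q : R -> R) (H : R -> R -> R),
  [/\ continuous q /\ continuous (fun z => H z.1 z.2),
      forall x : R, a <= x -> q x = 0, forall s r : R, a <= s -> H s r = 0,
      forall u v : R, 0 <= u -> 0 <= v -> v <= a -> H u v = cint (fun s => hker q H s v) u a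
    & forall u : R, 0 <= u -> u <= a -> H u u = 2^-1 * A u].
Proof.
move=> a0 delta0 small cdA dAA dA_le Aa dAa.
have cp : continuous (fun x => - dA x) by cont.
have p_le x : `|- dA x| <= delta by rewrite normrN.
have [q [H [cq cH qE HE]]] := inverse_fixpoint a0 delta0 small cp p_le.
have H0 s r : a <= s -> H s r = 0.
  by move=> sa; rewrite HE /kernelmap (clamp_ge a0 sa) cint_refl.
have q0 x : a <= x -> q x = 0.
  move=> xa; rewrite qE /potentialmap (clamp_ge a0 xa) dAa oppr0 cint_refl.
  rewrite (_ : (fun r => _) = (fun=> 0)) ?cint0; first by ring.
  by apply/funext => r; rewrite H0 ?lexx// mulr0.
have cg := cont_hker cq cH.
have g0 s v : a <= s -> hker q H s v = 0.
  move=> sa; rewrite /hker q0// mulr0 add0r (_ : (fun r => _) = (fun=> 0)) ?cint0//.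
  by apply/funext => r; rewrite H0// mulr0.
have HI u v : 0 <= u -> 0 <= v -> v <= a -> H u v = cint (fun s => hker q H s v) u a.
  move=> u0 v0 va; have cgv : continuous (fun s => hker q H s v) by cont.
  have [ua|/ltW au] := leP u a.
    by rewrite HE /kernelmap !clamp_id.
  rewrite H0// cint_sym (eq_cint0 (f := fun s => hker q H s v)) ?oppr0// => x /ltW ax _.
  exact: g0.
exists q, H; split => // u u0 ua.
pose D x := cint (fun s => hker q H s x) x a.
have cd : continuous (fun z : R * R => q (z.2 - z.1) * H z.2 z.1) by cont.
have dD (x : R) : is_derive x 1 D (cint (fun s => q (s - x) * H s x) x a - hker q H x x).
  apply: (@der_cint_leibniz _ (fun x s => hker q H s x) (fun x s => q (s - x) * H s x)) => //.
    by cont.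
  move=> v s; rewrite /hker.
  have ci : continuous (fun r => q (s - r) * H s r) by cont.
  by apply: (der_eq (derD (der_cst v (2^-1 * q s)) (der_cint 0 v ci))); rewrite add0r.
have dDA (x : R) : u < x -> x < a -> is_derive x 1 (fun x => D x - 2^-1 * A x) (0 : R).
  move=> ux xa; apply: (der_eq (derB (dD x) (derZ 2^-1 (dAA x)))).
  have x0 : 0 <= x by exact: le_trans (ltW ux).
  have := qE x; rewrite /potentialmap /hker clamp_id ?(ltW xa)// => ->.
  by field.
have cDA : continuous (fun x => D x - 2^-1 * A x).
  have c1 := der_cont dD; have c2 := der_cont dAA; cont.
have := der0_cst ua cDA dDA; rewrite Aa mulr0 subr0 {2}/D cint_refl => /eqP.
by rewrite subr_eq0 HI// => /eqP.
Qed.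

(** * Jost solutions *)

Section JostTransform.
Context {R : realType} (a : R) (q : R -> R) (H : R -> R -> R).
Context (a0 : 0 < a) (cq : continuous q) (cH : continuous (fun z => H z.1 z.2))
  (q0 : forall x : R, a <= x -> q x = 0) (H0 : forall s r : R, a <= s -> H s r = 0)
  (HI : forall u v : R, 0 <= u -> 0 <= v -> v <= a -> H u v = cint (fun s => hker q H s v) u a).

(** Equals [H] for [0 <= u] and [0 <= v <= a]. Without the clamp on [u] it is differentiable in [u]
    on the whole line, with no corner at 0 or [a]. *)
Definition kernel_ext (u v : R) : R := cint (fun s => hker q H s v) u a.

Lemma hker0 s v : a <= s -> hker q H s v = 0.
Proof.
move=> sa; rewrite /hker q0// mulr0 add0r (_ : (fun r => _) = (fun=> 0)) ?cint0//.
by apply/funext => r; rewrite H0// mulr0.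
Qed.

Lemma kernel_ext0 u v : a <= u -> kernel_ext u v = 0.
Proof.
have cg := cont_hker cq cH => ua; rewrite /kernel_ext cint_sym (eq_cint0 (f := fun s => hker q H s v)) ?oppr0//.
  by cont.
by move=> x /ltW ax _; exact: hker0.
Qed.

Lemma cont_kernel_ext : continuous (fun z => kernel_ext z.1 z.2).
Proof.
have cg := cont_hker cq cH.
by apply: (@cont_cint _ _ (fun z s => hker q H s z.2) (fun z => z.1) (fun=> a)); cont.
Qed.

Lemma der_kernel_ext (u v : R) : is_derive u 1 (kernel_ext ^~ v) (- hker q H u v).
Proof.
have cg := cont_hker cq cH.
have cgv : continuous (fun s => hker q H s v) by cont.
rewrite (_ : kernel_ext ^~ v = (fun u => - cint (fun s => hker q H s v) a u)).
  by apply: derN; exact: der_cint.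
by apply/funext => w; rewrite /kernel_ext cint_sym.
Qed.

(** [E] stands for the real or the imaginary part of e^{2iky}, which keeps the calculus real. *)
Definition jost_int (E : R -> R) (x : R) : R := cint (fun y => kernel_ext (x + y) y * E y) 0 a.
Definition djost_int (E : R -> R) (x : R) : R := cint (fun y => hker q H (x + y) y * E y) 0 a.

Lemma cont_djost_int E : continuous E -> continuous (djost_int E).
Proof.
move=> cE; have cg := cont_hker cq cH.
by apply: (@cont_cint0 _ _ (fun x y => hker q H (x + y) y * E y)); [exact: ltW|cont].
Qed.

Lemma der_jost_int E (x : R) : continuous E -> is_derive x 1 (jost_int E) (- djost_int E x).
Proof.
move=> cE; have cg := cont_hker cq cH; have cHx := cont_kernel_ext.
rewrite /djost_int -cintN; last by cont.
apply: (@der_cint_param _ (fun x y => kernel_ext (x + y) y * E y) (fun x y => - (hker q H (x + y) y * E y))).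
- exact: ltW.
- by cont.
- by cont.
- move=> t y.
  have ds : is_derive t (1 : R) (fun t : R => t + y) 1.
    by apply: (der_eq (derD (der_id t) (der_cst t y))); rewrite addr0.
  apply: (der_eq (derM (@der_comp _ (kernel_ext ^~ y) (fun t => t + y) t _ _ (der_kernel_ext _ _) ds) (der_cst t (E y)))).
  by ring.
Qed.

(* The limits of the integral move with [x], but now only the [v]-derivative of
   [hker] is needed to differentiate; the [u]-derivative would involve q'. *)
Lemma djost_int_moving E (x : R) : continuous E -> 0 <= x ->
  djost_int E x = cint (fun z => hker q H z (z - x) * E (z - x)) x a.
Proof.
move=> cE x0; have cg := cont_hker cq cH.
have cG : continuous (fun z => hker q H z (z - x) * E (z - x)) by cont.
have := cint_shift x 0 a cG; rewrite addr0 (@cint_chasles _ _ a x (x + a)).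
rewrite (@eq_cint0 _ _ a (x + a)) ?lerDr//; last by move=> y /ltW ya _; rewrite hker0// mul0r.
rewrite addr0 => <-; rewrite /djost_int.
by apply: (congr1 (fun g => cint g 0 a)); apply/funext => y; rewrite addrAC subrr add0r.
Qed.

Lemma jost_int_moving E (x : R) : continuous E -> 0 <= x ->
  jost_int E x = cint (fun z => H z (z - x) * E (z - x)) x a.
Proof.
move=> cE x0; have cHx := cont_kernel_ext.
have cG : continuous (fun z => kernel_ext z (z - x) * E (z - x)) by cont.
have cG' : continuous (fun z => H z (z - x) * E (z - x)) by cont.
have := cint_shift x 0 a cG; rewrite addr0 (@cint_chasles _ _ a x (x + a)).
rewrite (@eq_cint0 _ _ a (x + a)) ?lerDr//; last by move=> y /ltW ya _; rewrite kernel_ext0// mul0r.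
rewrite addr0 /jost_int.
rewrite [X in X = _ -> _](_ : _ = cint (fun y => kernel_ext (x + y) y * E y) 0 a); last first.
  by apply: (congr1 (fun g => cint g 0 a)); apply/funext => y; rewrite addrAC subrr add0r.
move=> ->; have [xa|/ltW ax] := leP x a.
  apply: eq_cint => // z xz za; rewrite HI//; [exact: le_trans (ltW xz)|lra|lra].
rewrite cint_sym [RHS]cint_sym; congr (- _); apply: eq_cint => // z /ltW az _.
by rewrite kernel_ext0// H0.
Qed.

(** In the moving form, the [v]-derivative of [hker] at [v = z - x] is [q x * H z (z - x)]: its
    factor [q x] does not depend on [z] and leaves the integral. The boundary term at [z = x] is
    [hker q H x 0 * E 0], where only the half of [q x] survives. *)
Lemma der_djost_int (E E' : R -> R) (x : R) : continuous E' ->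
  (forall y : R, is_derive y 1 E (E' y)) -> 0 < x ->
  is_derive x 1 (djost_int E) (- (q x * (2^-1 * E 0 + jost_int E x) + djost_int E' x)).
Proof.
move=> cE' dE x0; have cE := der_cont dE; have cg := cont_hker cq cH.
apply: (@near_eq_is_derive _ _ _ (fun x => cint (fun z => hker q H z (z - x) * E (z - x)) x a)).
  near=> y; rewrite djost_int_moving//.
  have : `|x - y| < x by near: y; exact: nbhsx_ballx.
  by have := ler_norm (x - y); lra.
pose F' (x z : R) := - (q x * (H z (z - x) * E (z - x)) + hker q H z (z - x) * E' (z - x)).
have dF (t z : R) : is_derive t 1 (fun t => hker q H z (z - t) * E (z - t)) (F' t z).
  have ds : is_derive t (1 : R) (fun t : R => z - t) (-1).
    by apply: (der_eq (derB (der_cst t z) (der_id t))); rewrite sub0r.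
  have ci : continuous (fun r => q (z - r) * H z r) by cont.
  have dg (v : R) : is_derive v 1 (hker q H z) (q (z - v) * H z v).
    by apply: (der_eq (derD (der_cst v (2^-1 * q z)) (der_cint 0 v ci))); rewrite add0r.
  apply: (der_eq (derM (@der_comp _ (hker q H z) (fun t => z - t) t _ _ (dg _) ds)
    (@der_comp _ E (fun t => z - t) t _ _ (dE _) ds))).
  by rewrite /F' subKr; ring.
apply: (der_eq (@der_cint_leibniz _ (fun x z => hker q H z (z - x) * E (z - x)) F' a x _ _ dF)).
- by cont.
- by rewrite /F'; cont.
rewrite /F' cintN; last by cont.
rewrite cintD; [|by cont|by cont].
rewrite cintZ; last by cont.
rewrite -jost_int_moving ?ltW// -djost_int_moving ?ltW// subrr /hker cint_refl.
by ring.
Unshelve. all: end_near. Qed.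

Lemma jost_int0 E (x : R) : continuous E -> a <= x -> jost_int E x = 0.
Proof.
move=> cE ax; apply: eq_cint0; first exact: ltW.
  by have cHx := cont_kernel_ext; cont.
by move=> y /ltW y0 _; rewrite kernel_ext0 ?mul0r//; apply: (le_trans ax); rewrite lerDl.
Qed.

Lemma djost_intD E F (x : R) (c d : R) : continuous E -> continuous F ->
  djost_int (fun y => c * E y + d * F y) x = c * djost_int E x + d * djost_int F x.
Proof.
move=> cE cF; have cg := cont_hker cq cH.
rewrite /djost_int -!cintZ -?cintD; [|by cont..].
by apply: (congr1 (fun g => cint g 0 a)); apply/funext => y; ring.
Qed.
End JostTransform.

(** * Complex-valued functions of a real variable *)

Section ComplexCalculus.
Context {R : realType}.
Implicit Types (f g : R -> R[i]) (k z w : R[i]).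

Lemma complex_ext z w : complex.Re z = complex.Re w -> complex.Im z = complex.Im w -> z = w.
Proof. by case: z w => [a b] [c d] /= -> ->. Qed.
Lemma Re_add z w : complex.Re (z + w) = complex.Re z + complex.Re w. Proof. by case: z w => [a b] []. Qed.
Lemma Im_add z w : complex.Im (z + w) = complex.Im z + complex.Im w. Proof. by case: z w => [a b] []. Qed.
Lemma Re_opp z : complex.Re (- z) = - complex.Re z. Proof. by case: z. Qed.
Lemma Im_opp z : complex.Im (- z) = - complex.Im z. Proof. by case: z. Qed.
Lemma Re_mul z w : complex.Re (z * w) = complex.Re z * complex.Re w - complex.Im z * complex.Im w.
Proof. by case: z w => [a b] []. Qed.
Lemma Im_mul z w : complex.Im (z * w) = complex.Re z * complex.Im w + complex.Im z * complex.Re w.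
Proof. by case: z w => [a b] [c d]. Qed.

Definition ccont f := continuous (fun x => complex.Re (f x)) /\ continuous (fun x => complex.Im (f x)).

Lemma ccontM f g : ccont f -> ccont g -> ccont (fun x => f x * g x).
Proof.
move=> [f1 f2] [g1 g2]; split.
  rewrite (_ : (fun x => _) = fun x => complex.Re (f x) * complex.Re (g x) - complex.Im (f x) * complex.Im (g x)).
    by apply: contB; apply: contM.
  by apply/funext => x; rewrite Re_mul.
rewrite (_ : (fun x => _) = fun x => complex.Re (f x) * complex.Im (g x) + complex.Im (f x) * complex.Re (g x)).
  by apply: contD; apply: contM.
by apply/funext => x; rewrite Im_mul.
Qed.

Lemma ccontD f g : ccont f -> ccont g -> ccont (fun x => f x + g x).
Proof.
move=> [f1 f2] [g1 g2]; split.
  rewrite (_ : (fun x => _) = fun x => complex.Re (f x) + complex.Re (g x)); first exact: contD.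
  by apply/funext => x; rewrite Re_add.
rewrite (_ : (fun x => _) = fun x => complex.Im (f x) + complex.Im (g x)); first exact: contD.
by apply/funext => x; rewrite Im_add.
Qed.

Lemma ccont_cst k : ccont (fun=> k).
Proof. by split; exact: cont_cst. Qed.

Lemma has_derivM f g (x : R) (d e : R[i]) : has_deriv f x d -> has_deriv g x e ->
  has_deriv (fun x => f x * g x) x (f x * e + d * g x).
Proof.
move=> [f1 f2] [g1 g2]; split.
  apply: (@der_ext _ (fun x => complex.Re (f x) * complex.Re (g x) - complex.Im (f x) * complex.Im (g x))).
    by move=> y; rewrite Re_mul.
  by apply: (der_eq (derB (derM f1 g1) (derM f2 g2))); rewrite Re_add !Re_mul; ring.
apply: (@der_ext _ (fun x => complex.Re (f x) * complex.Im (g x) + complex.Im (f x) * complex.Re (g x))).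
  by move=> y; rewrite Im_mul.
by apply: (der_eq (derD (derM f1 g2) (derM f2 g1))); rewrite Im_add !Im_mul; ring.
Qed.

Lemma has_derivD f g (x : R) (d e : R[i]) : has_deriv f x d -> has_deriv g x e ->
  has_deriv (fun x => f x + g x) x (d + e).
Proof.
move=> [f1 f2] [g1 g2]; split.
  apply: (@der_ext _ (fun x => complex.Re (f x) + complex.Re (g x))); first by move=> y; rewrite Re_add.
  by rewrite Re_add; exact: derD.
apply: (@der_ext _ (fun x => complex.Im (f x) + complex.Im (g x))); first by move=> y; rewrite Im_add.
by rewrite Im_add; exact: derD.
Qed.

Lemma has_deriv_cst k (x : R) : has_deriv (fun=> k) x 0.
Proof. by split; exact: der_cst. Qed.

Lemma has_derivZ k f (x : R) (d : R[i]) : has_deriv f x d -> has_deriv (fun x => k * f x) x (k * d).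
Proof.
move=> df; have := has_derivM (has_deriv_cst k x) df.
by rewrite mul0r addr0.
Qed.

Lemma has_deriv_eq f (x : R) (d e : R[i]) : has_deriv f x d -> d = e -> has_deriv f x e.
Proof. by move=> df <-. Qed.

Definition cexpr k (y : R) : R[i] := cexp (k * y%:C).

Lemma cexprE k (y : R) : cexpr k y =
  (expR (complex.Re k * y) * cos (complex.Im k * y)) +i* (expR (complex.Re k * y) * sin (complex.Im k * y)).
Proof.
by case: k => k1 k2; rewrite /cexpr /cexp Re_mul Im_mul /= !mulr0 subr0 add0r.
Qed.

Lemma cexpr0 k : cexpr k 0 = 1.
Proof. by rewrite cexprE !mulr0 expR0 cos0 sin0 mulr1 mulr0. Qed.

Lemma cexprD k (x y : R) : cexpr k (x + y) = cexpr k x * cexpr k y.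
Proof.
rewrite !cexprE !mulrDr expRD cosD sinD; apply: complex_ext; rewrite ?Re_mul ?Im_mul /=; ring.
Qed.

Lemma has_deriv_cexpr k (x : R) : has_deriv (cexpr k) x (k * cexpr k x).
Proof.
have dl (c : R) : is_derive x (1 : R) (fun y : R => c * y) c.
  by apply: (der_eq (derZ c (der_id x))); rewrite mulr1.
have de := @der_comp _ expR (fun y => complex.Re k * y) x _ _ (is_derive_expR _) (dl _).
have dc := @der_comp _ cos (fun y => complex.Im k * y) x _ _ (is_derive_cos _) (dl _).
have ds := @der_comp _ sin (fun y => complex.Im k * y) x _ _ (is_derive_sin _) (dl _).
split.
  apply: (@der_ext _ (fun y => expR (complex.Re k * y) * cos (complex.Im k * y))); first by move=> y; rewrite cexprE.
  by apply: (der_eq (derM de dc)); rewrite Re_mul cexprE /=; ring.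
apply: (@der_ext _ (fun y => expR (complex.Re k * y) * sin (complex.Im k * y))); first by move=> y; rewrite cexprE.
by apply: (der_eq (derM de ds)); rewrite Im_mul cexprE /=; ring.
Qed.

Lemma ccont_cexpr k : ccont (cexpr k).
Proof. by split; apply: der_cont => x; case: (has_deriv_cexpr k x); eauto. Qed.

Lemma cont_bounded (f : R -> R) (a b : R) : a <= b -> continuous f ->
  exists2 M : R, 0 < M & forall x, a <= x -> x <= b -> `|f x| <= M.
Proof.
move=> ab cf.
have cn : continuous (fun x => `|f x|).
  by move=> x; apply: (@continuous_comp _ _ _ f Num.norm); [exact: cf|exact: norm_continuous].
have [c _ cm] := @EVT_max R (fun x => `|f x|) a b ab (continuous_subspaceT cn).
exists (`|f c| + 1); first by have := normr_ge0 (f c); lra.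
by move=> x ax xb; have := cm x; rewrite in_itv /= ax xb => /(_ isT); lra.
Qed.

Lemma C1_abs_continuous (f df : R -> R) (b : R) : 0 < b -> continuous f -> continuous df ->
  (forall x : R, 0 < x -> is_derive x 1 f (df x)) -> abs_continuous_on 0 b f.
Proof.
move=> b0 cf cdf dfE e e0.
have [M M0 HM] := cont_bounded (ltW b0) cdf.
exists (e / M); first by rewrite divr_gt0.
move=> n s t st _ ste.
apply: (@le_lt_trans _ _ (M * \sum_(i < n) (t i - s i))); last by rewrite mulrC -ltr_pdivlMr.
rewrite mulr_sumr; apply: ler_sum => i _.
have [s0 [stl tb]] := st i.
apply: (@der_bound _ f df) => // x sx xt.
  by apply: dfE; exact: le_lt_trans sx.
by apply: HM; [exact: le_trans (ltW sx)|exact: le_trans (ltW xt) tb].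
Qed.

Lemma C1_loc_abs_continuous f df : ccont f -> ccont df ->
  (forall x : R, 0 < x -> has_deriv f x (df x)) -> loc_abs_continuous f.
Proof.
move=> [f1 f2] [d1 d2] H b b0; split.
  by apply: (C1_abs_continuous b0 f1 d1) => x /H[].
by apply: (C1_abs_continuous b0 f2 d2) => x /H[].
Qed.
End ComplexCalculus.

(* The solution is psi = e^{ikx} m with m = 1 + 2 int_0^a H(x + y, y) e^{2iky} dy. *)
Lemma transmutation_jost (R : realType) (a : R) (q : R -> R) (H : R -> R -> R) :
  0 < a -> continuous q -> continuous (fun z => H z.1 z.2) ->
  (forall x : R, a <= x -> q x = 0) -> (forall s r : R, a <= s -> H s r = 0) ->
  (forall u v : R, 0 <= u -> 0 <= v -> v <= a -> H u v = cint (fun s => hker q H s v) u a) ->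
  forall k : R[i], exists2 psi : R -> R[i], jost_solution q k psi &
    psi 0 = (1 + 2 * cint (fun y => H y y * complex.Re (cexpr (2 * ('i%C * k)) y)) 0 a) +i*
            (2 * cint (fun y => H y y * complex.Im (cexpr (2 * ('i%C * k)) y)) 0 a).
Proof.
move=> a0 cq cH q0 H0 HI k.
pose mu := 2 * ('i%C * k).
pose E1 y := complex.Re (cexpr mu y); pose E2 y := complex.Im (cexpr mu y).
have [cE1 cE2] : continuous E1 /\ continuous E2 by exact: ccont_cexpr.
(* The real and imaginary parts of [mu * cexpr mu y], written as real combinations to which
   [djost_intD] applies. *)
pose F1 y := complex.Re mu * E1 y + (- complex.Im mu) * E2 y.
pose F2 y := complex.Re mu * E2 y + complex.Im mu * E1 y.
have cF1 : continuous F1 by rewrite /F1; cont.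
have cF2 : continuous F2 by rewrite /F2; cont.
have dE1 (y : R) : is_derive y 1 E1 (F1 y).
  by case: (has_deriv_cexpr mu y) => h _; apply: (der_eq h); rewrite Re_mul /F1 /E1 /E2; ring.
have dE2 (y : R) : is_derive y 1 E2 (F2 y).
  by case: (has_deriv_cexpr mu y) => _ h; apply: (der_eq h); rewrite Im_mul /F2 /E1 /E2; ring.
pose P := jost_int a q H; pose N := djost_int a q H.
pose m x : R[i] := (1 + 2 * P E1 x) +i* (2 * P E2 x).
pose dm x : R[i] := (- (2 * N E1 x)) +i* (- (2 * N E2 x)).
have dP E (x : R) : continuous E -> is_derive x 1 (P E) (- N E x) by exact: der_jost_int.
have cN E : continuous E -> continuous (N E) by exact: cont_djost_int.
have cP E : continuous E -> continuous (P E) by move=> cE; apply: der_cont => x; exact: dP.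
have dmE x : has_deriv m x (dm x).
  split => /=.
    by apply: (der_eq (derD (der_cst x 1) (derZ 2 (dP _ x cE1)))); ring.
  by apply: (der_eq (derZ 2 (dP _ x cE2))); ring.
have [E10 E20] : E1 0 = 1 /\ E2 0 = 0 by rewrite /E1 /E2 cexpr0.
have dN E E' (x : R) : continuous E' -> (forall y : R, is_derive y 1 E (E' y)) -> 0 < x ->
   is_derive x 1 (N E) (- (q x * (2^-1 * E 0 + P E x) + N E' x)).
  by move=> *; exact: der_djost_int.
(* This is m'' + 2ik m' = q m, the Schrodinger equation for psi = e^{ikx} m. *)
have ddm (x : R) : 0 < x -> has_deriv dm x ((q x)%:C * m x - mu * dm x).
  move=> x0; split => /=.
    apply: (der_eq (derN (derZ 2 (dN _ _ x cF1 dE1 x0)))).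
    by rewrite /N /F1 djost_intD// -/N E10 Re_add Re_opp !Re_mul /=; field.
  apply: (der_eq (derN (derZ 2 (dN _ _ x cF2 dE2 x0)))).
  by rewrite /N /F2 djost_intD// -/N E20 Im_add Im_opp !Im_mul /=; field.
pose K := 'i%C * k; pose e := cexpr K.
have muE : mu = 2 * K by [].
pose psi x := e x * m x.
pose dpsi x := e x * (K * m x + dm x).
pose ddpsi x := e x * ((q x)%:C * m x + K ^+ 2 * m x).
have cm : ccont m.
  by split => /=; have := cP _ cE1; have := cP _ cE2 => ? ?; cont.
have cdm : ccont dm.
  by split => /=; have := cN _ cE1; have := cN _ cE2 => ? ?; cont.
have ce : ccont e by exact: ccont_cexpr.
have cqc : ccont (fun x => (q x)%:C) by split => //=; exact: cont_cst.
have cK c : ccont (fun=> c : R[i]) by exact: ccont_cst.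
have cpsi : ccont psi by exact: ccontM.
have cdpsi : ccont dpsi by apply: ccontM => //; apply: ccontD => //; exact: ccontM.
have cddpsi : ccont ddpsi.
  by apply: ccontM => //; apply: ccontD; exact: ccontM.
have dpsiE (x : R) : has_deriv psi x (dpsi x).
  by apply: (has_deriv_eq (has_derivM (has_deriv_cexpr K x) (dmE x))); rewrite /dpsi /e; ring.
have ddpsiE (x : R) : 0 < x -> has_deriv dpsi x (ddpsi x).
  move=> x0; apply: (has_deriv_eq (has_derivM (has_deriv_cexpr K x)
    (has_derivD (has_derivZ K (dmE x)) (ddm x x0)))).
  by rewrite /ddpsi /e muE; ring.
have K2 : K ^+ 2 = - k ^+ 2.
  by rewrite /K exprMn sqr_i mulN1r.
have P0 E : continuous E -> P E 0 = cint (fun y => H y y * E y) 0 a.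
  move=> cE; rewrite /P jost_int_moving//.
  by apply: (congr1 (fun g => cint g 0 a)); apply/funext => y; rewrite subr0.
exists psi; last by rewrite /psi /e cexpr0 mul1r /m !P0.
split.
  exists dpsi; split.
  - by apply: (C1_loc_abs_continuous cpsi cdpsi) => x _.
  - exact: (C1_loc_abs_continuous cdpsi cddpsi).
  - by move=> x _.
  - apply: aeW => x /= x0; exists (ddpsi x); first exact: ddpsiE.
    by rewrite /ddpsi /psi K2; ring.
exists a => x ax; rewrite /psi /m /P !jost_int0// mulr0 addr0.
by rewrite /e /cexpr mulr1.
Qed.

(** * Convolution products *)

Section Convolution.
Context {R : realType}.
Implicit Types (f g df dg E : R -> R) (mu : R[i]).

(** A single [e] bounds the function and its derivative: a convolution is differentiated by
    differentiating one factor only, so both bounds multiply in the same way. *)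
Record C1supp (L e : R) (f df : R -> R) : Prop := C1Supp {
  c1_cont : continuous df;
  c1_der : forall x : R, is_derive x 1 f (df x);
  c1_le0 : forall x, x <= 0 -> f x = 0 /\ df x = 0;
  c1_geL : forall x, L <= x -> f x = 0 /\ df x = 0;
  c1_bound : forall x, `|f x| <= e /\ `|df x| <= e }.

Lemma c1_contf L e f df : C1supp L e f df -> continuous f.
Proof. by move=> s; apply: der_cont (c1_der s). Qed.

Lemma C1suppW L e L' e' f df : L <= L' -> e <= e' -> C1supp L e f df -> C1supp L' e' f df.
Proof.
move=> LL ee [c d h0 hL b]; split=> // x; first by move=> /(le_trans LL); exact: hL.
by case: (b x) => ? ?; split; exact: le_trans ee.
Qed.

Lemma C1suppD L e e' f df g dg : C1supp L e f df -> C1supp L e' g dg ->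
  C1supp L (e + e') (fun x => f x + g x) (fun x => df x + dg x).
Proof.
move=> [c d h0 hL b] [c' d' h0' hL' b']; split.
- exact: contD.
- by move=> x; exact: derD.
- by move=> x x0; have [-> ->] := h0 x x0; have [-> ->] := h0' x x0; rewrite addr0.
- by move=> x x0; have [-> ->] := hL x x0; have [-> ->] := hL' x x0; rewrite addr0.
- move=> x; have [b1 b2] := b x; have [b1' b2'] := b' x.
  by split; rewrite (le_trans (ler_normD _ _))// lerD.
Qed.

Definition conv (L : R) f g (t : R) : R := cint (fun s => f s * g (t - s)) 0 L.

Lemma C1supp_conv L e L' e' f df g dg : 0 <= L -> C1supp L e f df -> C1supp L' e' g dg ->
  C1supp (L + L') (L * e * e') (conv L f g) (conv L f dg).
Proof.
move=> L0 sf sg.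
have cf := c1_contf sf; have cg := c1_contf sg; have cdg := c1_cont sg.
have c1 t : continuous (fun s => f s * g (t - s)) by cont.
have c2 t : continuous (fun s => f s * dg (t - s)) by cont.
split.
- by apply: cont_cint0 => //; cont.
- move=> x; apply: (@der_cint_param _ (fun t s => f s * g (t - s)) (fun t s => f s * dg (t - s))) => //.
  + by cont.
  + by cont.
  + move=> t s.
    have ds : is_derive t (1 : R) (fun t : R => t - s) 1.
      by apply: (der_eq (derB (der_id t) (der_cst t s))); rewrite subr0.
    by apply: (der_eq (derZ (f s) (@der_comp _ g (fun t => t - s) t _ _ (c1_der sg _) ds))); rewrite mulr1.
- move=> x x0; split; apply: eq_cint0 => // s s0 _.
    by rewrite (proj1 (c1_le0 sg _)) ?mulr0//; lra.
  by rewrite (proj2 (c1_le0 sg _)) ?mulr0//; lra.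
- move=> x x0; split; apply: eq_cint0 => // s s0 sL.
    by rewrite (proj1 (c1_geL sg _)) ?mulr0//; lra.
  by rewrite (proj2 (c1_geL sg _)) ?mulr0//; lra.
- have e0 : 0 <= e by case: (c1_bound sf 0) => h _; exact: le_trans h.
  move=> x; rewrite /conv -mulrA mulrC; split.
    rewrite -{2}(subr0 L); apply: cint_bound => // s _ _; rewrite normrM.
    by apply: ler_pM => //; [case: (c1_bound sf s)|case: (c1_bound sg (x - s))].
  rewrite -{2}(subr0 L); apply: cint_bound => // s _ _; rewrite normrM.
  by apply: ler_pM => //; [case: (c1_bound sf s)|case: (c1_bound sg (x - s))].
Qed.

Definition laplace mu f (L : R) : R[i] :=
  cint (fun y => f y * complex.Re (cexpr mu y)) 0 L +i*
  cint (fun y => f y * complex.Im (cexpr mu y)) 0 L.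

Lemma cint_widen f (L L' : R) : 0 <= L -> L <= L' -> continuous f ->
  (forall x, L <= x -> f x = 0) -> cint f 0 L' = cint f 0 L.
Proof.
move=> L0 LL cf f0; rewrite (@cint_chasles _ _ L 0 L') (@eq_cint0 _ _ L L') ?addr0//.
by move=> x /ltW Lx _; exact: f0.
Qed.

Lemma laplace_widen mu L e f df L' : 0 <= L -> L <= L' -> C1supp L e f df ->
  laplace mu f L' = laplace mu f L.
Proof.
move=> L0 LL s; have cf := c1_contf s; have [c1 c2] := @ccont_cexpr R mu.
rewrite /laplace; congr (_ +i* _); apply: cint_widen => //; try by apply: contM.
  by move=> x /(c1_geL s)[-> _]; rewrite mul0r.
by move=> x /(c1_geL s)[-> _]; rewrite mul0r.
Qed.

Lemma laplaceD mu f g (L : R) : continuous f -> continuous g ->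
  laplace mu (fun x => f x + g x) L = laplace mu f L + laplace mu g L.
Proof.
move=> cf cg; have [c1 c2] := @ccont_cexpr R mu.
have E e : continuous e -> cint (fun y => (f y + g y) * e y) 0 L =
    cint (fun y => f y * e y) 0 L + cint (fun y => g y * e y) 0 L.
  move=> ce; rewrite -cintD; [|by cont..].
  by apply: (congr1 (fun h => cint h 0 L)); apply/funext => y; rewrite mulrDl.
by rewrite /laplace (E _ c1) (E _ c2).
Qed.

(** Fubini and the shift of [t] by [s]. The weight [E] is general because the real and imaginary
    parts of an exponential are not multiplicative separately; their addition formulas come in
    afterwards. *)
Lemma conv_moment (L L' e e' : R) f df g dg E : 0 <= L -> 0 <= L' ->
  C1supp L e f df -> C1supp L' e' g dg -> continuous E ->
  cint (fun t => conv L f g t * E t) 0 (L + L') =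
  cint (fun s => f s * cint (fun t => g t * E (s + t)) 0 L') 0 L.
Proof.
move=> L0 L'0 sf sg cE; have cf := c1_contf sf; have cg := c1_contf sg.
have LL : 0 <= L + L' by exact: addr_ge0.
transitivity (cint (fun t => cint (fun s => f s * g (t - s) * E t) 0 L) 0 (L + L')).
  apply: (congr1 (fun h => cint h 0 _)); apply/funext => t; rewrite /conv mulrC -cintZ; last by cont.
  by apply: (congr1 (fun h => cint h 0 _)); apply/funext => s; rewrite mulrC.
rewrite (@cint_fubini _ (fun t s => f s * g (t - s) * E t)) //; last by cont.
apply: eq_cint => //.
- apply: (@cont_cint0 _ _ (fun s t => f s * g (t - s) * E t)) => //; cont.
- apply: contM => //; apply: (@cont_cint0 _ _ (fun s t => g t * E (s + t))) => //; cont.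
move=> s s0 sL; rewrite -cintZ; last by cont.
have cG : continuous (fun t => f s * g (t - s) * E t) by cont.
have cG' : continuous (fun y => f s * (g y * E (s + y))) by cont.
have := cint_shift s (- s) (L + L' - s) cG; rewrite subrr addrCA subrr addr0 => <-.
rewrite (_ : (fun y => _) = (fun y => f s * (g y * E (s + y)))); last first.
  by apply/funext => y; rewrite addrAC subrr add0r mulrA.
rewrite (@cint_chasles _ _ 0 (- s)) (@eq_cint0 _ _ (- s) 0) ?add0r//; last first.
- by move=> x _ /ltW x0; rewrite (proj1 (c1_le0 sg _))// mul0r mulr0.
- by rewrite oppr_le0 ltW.
apply: cint_widen => //; first by lra.
by move=> x xL; rewrite (proj1 (c1_geL sg _))// mul0r mulr0.
Qed.

Lemma laplace_conv mu (L L' e e' : R) f df g dg : 0 <= L -> 0 <= L' ->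
  C1supp L e f df -> C1supp L' e' g dg ->
  laplace mu (conv L f g) (L + L') = laplace mu f L * laplace mu g L'.
Proof.
move=> L0 L'0 sf sg; have cf := c1_contf sf; have cg := c1_contf sg.
have [c1 c2] := @ccont_cexpr R mu.
pose E1 y := complex.Re (cexpr mu y); pose E2 y := complex.Im (cexpr mu y).
have cE1 : continuous E1 by [].
have cE2 : continuous E2 by [].
have E1D s t : E1 (s + t) = E1 s * E1 t - E2 s * E2 t by rewrite /E1 cexprD Re_mul.
have E2D s t : E2 (s + t) = E1 s * E2 t + E2 s * E1 t by rewrite /E2 cexprD Im_mul.
rewrite /laplace -/E1 -/E2.
rewrite (conv_moment L0 L'0 sf sg c1) (conv_moment L0 L'0 sf sg c2).
set F1 := cint (fun y => f y * E1 y) 0 L; set F2 := cint (fun y => f y * E2 y) 0 L.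
set G1 := cint (fun y => g y * E1 y) 0 L'; set G2 := cint (fun y => g y * E2 y) 0 L'.
have cgE1 : continuous (fun y => g y * E1 y) by apply: contM.
have cgE2 : continuous (fun y => g y * E2 y) by apply: contM.
have cfE1 : continuous (fun y => f y * E1 y) by apply: contM.
have cfE2 : continuous (fun y => f y * E2 y) by apply: contM.
apply: complex_ext; rewrite ?Re_mul ?Im_mul /=.
  transitivity (cint (fun s => G1 * (f s * E1 s) - G2 * (f s * E2 s)) 0 L).
    apply: (congr1 (fun h => cint h 0 L)); apply/funext => s.
    rewrite (_ : (fun t => _) = fun t => E1 s * (g t * E1 t) - E2 s * (g t * E2 t)).
      rewrite cintB; [|by apply: contM => //; exact: cont_cst..].
      by rewrite !cintZ//; rewrite -/G1 -/G2; ring.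
    by apply/funext => t; transitivity (g t * E1 (s + t)); [|rewrite E1D; ring].
  rewrite cintB; [|by apply: contM => //; exact: cont_cst..].
  by rewrite !cintZ//; rewrite -/F1 -/F2; ring.
transitivity (cint (fun s => G2 * (f s * E1 s) + G1 * (f s * E2 s)) 0 L).
  apply: (congr1 (fun h => cint h 0 L)); apply/funext => s.
  rewrite (_ : (fun t => _) = fun t => E1 s * (g t * E2 t) + E2 s * (g t * E1 t)).
    rewrite cintD; [|by apply: contM => //; exact: cont_cst..].
    by rewrite !cintZ//; rewrite -/G1 -/G2; ring.
  by apply/funext => t; transitivity (g t * E2 (s + t)); [|rewrite E2D; ring].
rewrite cintD; [|by apply: contM => //; exact: cont_cst..].
by rewrite !cintZ//; rewrite -/F1 -/F2; ring.
Qed.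
End Convolution.

(** * Infinite products of factors 1 + laplace *)

Section InfiniteProduct.
Context {R : realType} (a E : R) (l e : nat -> R) (g dg : nat -> R -> R).
Context (a0 : 0 < a) (l0 : forall n, 0 <= l n) (e0 : forall n, 0 <= e n)
  (gS : forall n, C1supp (l n) (e n) (g n) (dg n))
  (lE : forall n, \sum_(i < n) l i <= a) (eE : forall n, \sum_(i < n) e i <= E)
  (aE : a * E <= 2^-1).

Let Ln n := \sum_(i < n) l i.
Let Sn n := \sum_(i < n) e i.

(** The constant 1 is the transform of a unit mass at 0, which is not a function. It is left out, so
    multiplying by a factor adds [g m] and its convolution with [A] to [A]. The second component is
    the derivative. *)
Fixpoint product (n : nat) : (R -> R) * (R -> R) :=
  if n is m.+1 then
    let: (A, dA) := product m in
    (fun x => A x + g m x + conv (Ln m) A (g m) x, fun x => dA x + dg m x + conv (Ln m) A (dg m) x)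
  else (fun=> 0, fun=> 0).

Let Ln0 n : 0 <= Ln n. Proof. by apply: sumr_ge0. Qed.
Let Sn0 n : 0 <= Sn n. Proof. by apply: sumr_ge0. Qed.
Let LnS n : Ln n.+1 = Ln n + l n. Proof. by rewrite /Ln big_ord_recr. Qed.
Let SnS n : Sn n.+1 = Sn n + e n. Proof. by rewrite /Sn big_ord_recr. Qed.

(** By [aE], convolution with the partial product does not increase the size of a factor. Each
    factor thus adds at most [2 * e n], and the partial products stay bounded by twice the sum. *)
Let conv_small n : Ln n * (2 * Sn n) * e n <= e n.
Proof.
rewrite ler_piMl// mulrCA; have := ler_pM (Ln0 n) (Sn0 n) (lE n) (eE n); rewrite -/(Ln n) -/(Sn n).
by have := aE; lra.
Qed.

Lemma product_supp n : C1supp (Ln n) (2 * Sn n) (product n).1 (product n).2.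
Proof.
elim: n => [|n IH].
  split => //=; [exact: cont_cst|by move=> x; exact: der_cst|].
  by move=> x; rewrite normr0 mulr_ge0.
have h1 : Ln n <= Ln n + l n by rewrite lerDl.
have h2 : l n <= Ln n + l n by rewrite lerDr.
have := C1suppD (C1suppD (C1suppW h1 (lexx _) IH) (C1suppW h2 (lexx _) (gS n)))
  (C1supp_conv (Ln0 n) IH (gS n)).
rewrite -LnS SnS /=; case: (product n) => A dA /=; apply: C1suppW => //.
by have := conv_small n; lra.
Qed.

Lemma product_step n x : `|(product n.+1).2 x - (product n).2 x| <= 2 * e n.
Proof.
have sc := C1supp_conv (Ln0 n) (product_supp n) (gS n).
have [_ h1] := c1_bound (gS n) x; have [_ h2] := c1_bound sc x.
move: h2 => /=; case: (product n) => A dA /= h2.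
rewrite (_ : _ - _ = dg n x + conv (Ln n) A (dg n) x); last by ring.
rewrite (le_trans (ler_normD _ _))//.
by have := conv_small n; lra.
Qed.

Lemma product_lap mu n : 1 + laplace mu (product n.+1).1 (Ln n.+1) =
  (1 + laplace mu (product n).1 (Ln n)) * (1 + laplace mu (g n) (l n)).
Proof.
have sp := product_supp n; have sc := C1supp_conv (Ln0 n) sp (gS n).
have cp := c1_contf sp; have cg := c1_contf (gS n); have cc := c1_contf sc.
have h1 : Ln n <= Ln n + l n by rewrite lerDl.
have h2 : l n <= Ln n + l n by rewrite lerDr.
have -> : (product n.+1).1 = (fun x => ((product n).1 x + g n x) + conv (Ln n) (product n).1 (g n) x).
  by rewrite /=; case: (product n).
rewrite laplaceD//; last exact: contD.
rewrite laplaceD// LnS (laplace_widen mu (Ln0 n) h1 sp) (laplace_widen mu (l0 n) h2 (gS n)).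
by rewrite (laplace_conv mu (Ln0 n) (l0 n) sp (gS n)); ring.
Qed.

(** The derivatives converge uniformly, and [A] is the primitive of their limit that vanishes at 0.
    A zero of one factor is a zero of all later partial products and passes to the limit, since the
    transform is an integral over the fixed segment [[0, a]]. *)
Lemma infinite_product : exists A dA : R -> R,
  [/\ continuous dA, forall x : R, is_derive x 1 A (dA x), forall x, `|dA x| <= 2 * E,
     A a = 0 /\ dA a = 0 &
     forall mu n, 1 + laplace mu (g n) (l n) = 0 -> 1 + laplace mu A a = 0].
Proof.
have s2 n : \sum_(i < n) 2 * e i <= 2 * E by rewrite -mulr_sumr ler_wpM2l.
have [B HB] := @uniform_cauchy R R (fun n => (product n).2) (fun n => 2 * e n) (2 * E)
  (fun n => mulr_ge0 (ler0n _ 2) (e0 n)) s2 product_step.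
have cB : continuous B.
  apply: cont_unif_lim => r r0; have [n0 /(_ n0 (leqnn _)) h] := HB r r0.
  by exists (product n0).2 => //; exact: c1_cont (product_supp n0).
have E0 : 0 <= E by have := eE 0%N; rewrite big_ord0.
pose A x := cint B 0 x.
have dA (x : R) : is_derive x 1 A (B x) by exact: der_cint.
have prodE n x : (product n).1 x = cint (product n).2 0 x.
  have sp := product_supp n.
  by rewrite (cint_ftcT 0 x (c1_cont sp) (c1_der sp)) (proj1 (c1_le0 sp (lexx 0))) subr0.
have HA r : 0 < r -> exists n0, forall n, (n0 <= n)%N -> forall x, 0 <= x -> x <= a ->
    `|A x - (product n).1 x| <= r.
  move=> r0; have [n0 h] := HB (r / a) (divr_gt0 r0 a0).
  exists n0 => n nn x x0 xa; rewrite prodE /A -cintB//; last exact: c1_cont (product_supp n).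
  have cc : continuous (fun y => B y - (product n).2 y).
    by apply: contB => //; exact: c1_cont (product_supp n).
  apply: (le_trans (cint_bound x0 cc (fun y _ _ => h n nn y))).
  by rewrite subr0 mulrAC ler_pdivrMr// ler_wpM2l// ltW.
have lim0 (x : R) : (forall r, 0 < r -> `|x| <= r) -> x = 0.
  move=> h; apply/eqP; rewrite -normr_le0; apply/ler_addgt0Pr => r r0.
  by rewrite add0r h.
exists A, B; split => //.
- move=> x; apply/ler_addgt0Pr => r r0; have [n0 /(_ n0 (leqnn _) x) h] := HB r r0.
  have [_ b] := c1_bound (product_supp n0) x.
  have := eE n0; rewrite -/(Sn n0); have := ler_normD (B x - (product n0).2 x) ((product n0).2 x).
  by rewrite subrK; lra.
- split; apply: lim0 => r r0.
    have [n0 /(_ n0 (leqnn _) a (ltW a0) (lexx _))] := HA r r0.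
    by rewrite (proj1 (c1_geL (product_supp n0) (lE n0))) subr0.
  have [n0 /(_ n0 (leqnn _) a)] := HB r r0.
  by rewrite (proj2 (c1_geL (product_supp n0) (lE n0))) subr0.
move=> mu n gn0.
have pz m : 1 + laplace mu (product (n.+1 + m)).1 (Ln (n.+1 + m)) = 0.
  elim: m => [|m IH]; first by rewrite addn0 product_lap gn0 mulr0.
  by rewrite addnS product_lap IH mul0r.
have {}pz m : 1 + laplace mu (product (n.+1 + m)).1 a = 0.
  by rewrite (laplace_widen mu (Ln0 _) (lE _) (product_supp _)).
have cA := der_cont dA.
have app e1 : continuous e1 -> forall r, 0 < r -> exists m,
   `|cint (fun y => A y * e1 y) 0 a - cint (fun y => (product (n.+1 + m)).1 y * e1 y) 0 a| <= r.
  move=> ce r r0; have [M M0 HM] := cont_bounded (ltW a0) ce.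
  have [n0 h] := HA (r / (M * a)) (divr_gt0 r0 (mulr_gt0 M0 a0)).
  exists n0; have cp := c1_contf (product_supp (n.+1 + n0)).
  rewrite -cintB; [|by apply: contM..].
  have bd y : 0 < y -> y < a -> `|A y * e1 y - (product (n.+1 + n0)).1 y * e1 y| <= r / (M * a) * M.
    move=> y0 ya; rewrite -mulrBl normrM; apply: ler_pM => //.
      by apply: h; [exact: leq_addl|exact: ltW|exact: ltW].
    by apply: HM; exact: ltW.
  have cc : continuous (fun y => A y * e1 y - (product (n.+1 + n0)).1 y * e1 y).
    by apply: contB; apply: contM.
  apply: (le_trans (cint_bound (ltW a0) cc bd)).
  have -> : r / (M * a) * M * (a - 0) = r by field; rewrite !gt_eqF.
  exact: lexx.
have [c1 c2] := @ccont_cexpr R mu.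
apply: complex_ext; rewrite ?Re_add ?Im_add /=; apply: lim0 => r r0.
  have [m h] := app _ c1 r r0; have := congr1 (@complex.Re R) (pz m).
  rewrite Re_add /= => /eqP; rewrite addrC addr_eq0 => /eqP E1; rewrite E1 opprK addrC in h.
  exact: h.
have [m h] := app _ c2 r r0; have := congr1 (@complex.Im R) (pz m).
by rewrite Im_add /= !add0r => E1; rewrite E1 subr0 in h.
Qed.
End InfiniteProduct.

(** * A factor vanishing at a prescribed point *)

Section Bump.
Context {R : realType}.

(** The remainder is at most [h ^+ 2] on both sides of the corner; squaring the positive part is
    what makes it C^1. *)
Lemma der_possq (x : R) :
  is_derive x 1 (fun y => Num.max 0 y ^+ 2) (2 * Num.max 0 x).
Proof.
apply: derP => e e0; near=> h.
have he : `|h| < e by near: h; exact: (@nbhs0_lt R R).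
have key : `|Num.max 0 (x + h) ^+ 2 - Num.max 0 x ^+ 2 - h * (2 * Num.max 0 x)| <= h ^+ 2.
  rewrite ler_norml; have [x0|/ltW x0] := leP 0 x; have [y0|/ltW y0] := leP 0 (x + h);
    by apply/andP; split; nra.
by rewrite (le_trans key)// -real_normK ?num_real// expr2 ler_wpM2r// ltW.
Unshelve. all: end_near. Qed.

(** Positive exactly between 1/2 and 1, with maximum 1/8 at 3/4. The half [[0, 1/2]] is left out
    because a decaying exponential is not small near 0. *)
Definition bump_base (t : R) : R := (2 * t - 1) * (1 - t).
Definition bump (t : R) : R := Num.max 0 (bump_base t) ^+ 2.
Definition dbump (t : R) : R := 2 * Num.max 0 (bump_base t) * (3 - 4 * t).

Lemma cont_bump_base : continuous bump_base. Proof. by rewrite /bump_base; cont. Qed.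
Lemma cont_bump : continuous bump.
Proof. by have c := cont_bump_base; rewrite /bump; cont. Qed.
Lemma cont_dbump : continuous dbump.
Proof. by have c := cont_bump_base; rewrite /dbump; cont. Qed.

Lemma der_bump (t : R) : is_derive t 1 bump (dbump t).
Proof.
have d : is_derive t 1 bump_base (3 - 4 * t).
  apply: (der_eq (derM (derB (derZ 2 (der_id t)) (der_cst t 1)) (derB (der_cst t 1) (der_id t)))).
  by ring.
by apply: (der_eq (@der_comp _ (fun y => Num.max 0 y ^+ 2) bump_base t _ _ (der_possq _) d)).
Qed.

Lemma bump_out (t : R) : t <= 2^-1 \/ 1 <= t -> bump t = 0 /\ dbump t = 0.
Proof.
move=> h; have b0 : bump_base t <= 0.
  by rewrite /bump_base; case: h => ?; nra.
by rewrite /bump /dbump max_l// expr0n mulr0 mul0r.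
Qed.

Lemma bump_bound (t : R) : `|bump t| <= 1 /\ `|dbump t| <= 1.
Proof.
have [th|th] := leP t 2^-1.
  by have [-> ->] := bump_out (or_introl th); rewrite normr0.
have [t1|t1] := leP 1 t.
  by have [-> ->] := bump_out (or_intror t1); rewrite normr0.
have b0 : 0 <= bump_base t by rewrite /bump_base; nra.
have b1 : bump_base t <= 8^-1.
  by have := sqr_ge0 (t - 3 / 4); rewrite /bump_base; nra.
rewrite /bump /dbump max_r//; split; first by rewrite ger0_norm ?sqr_ge0//; nra.
rewrite normrM (@ger0_norm _ (2 * _)); last by rewrite mulr_ge0.
have : `|3 - 4 * t| <= 1 by rewrite ler_norml; apply/andP; split; lra.
by have := normr_ge0 (3 - 4 * t); nra.
Qed.

Definition bump_mass : R := cint bump 0 1.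

Lemma bump_mass_gt0 : 0 < bump_mass.
Proof.
(* Between 7/10 and 8/10 the value of [bump_base] is at least 8/100, whose square exceeds 1/1000. *)
have cb := cont_bump; pose u : R := 7 / 10; pose v : R := 8 / 10.
rewrite /bump_mass (@cint_chasles _ _ u 0 1) (@cint_chasles _ _ v u 1).
have bge0 x : 0 <= bump x by exact: sqr_ge0.
have h1 : 0 <= cint bump 0 u by apply: cint_ge0 => //; rewrite /u; lra.
have h2 : 0 <= cint bump v 1 by apply: cint_ge0 => //; rewrite /v; lra.
have : 0 <= cint (fun x => bump x - 1000^-1) u v.
  apply: cint_ge0; [by rewrite /u /v; lra|by cont|move=> x ux xv].
  have : 8%:R / 100%:R <= bump_base x by rewrite /bump_base /u /v in ux xv *; nra.
  by move=> b; rewrite /bump max_r; [nra|lra].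
rewrite cintB//; last exact: cont_cst.
rewrite cint_cst; set I := cint _ _ _; rewrite /u /v; lra.
Qed.

(** The terms 1, [l^-1] and [K] of the size account for the function, the derivative of the rescaled
    bump and the derivative of [G]. *)
Lemma C1supp_bump (l c eta K : R) (G dG : R -> R) : 0 < l -> 0 <= c -> 0 <= eta -> 0 <= K ->
  continuous dG -> (forall x : R, is_derive x 1 G (dG x)) ->
  (forall x, l / 2 <= x -> `|G x| <= eta /\ `|dG x| <= eta * K) ->
  C1supp l (c * (eta * (1 + l^-1 + K))) (fun t => c * (bump (l^-1 * t) * G t))
    (fun t => c * (l^-1 * dbump (l^-1 * t) * G t + bump (l^-1 * t) * dG t)).
Proof.
move=> l0 c0 eta0 K0 cdG dGE GB.
have cG := der_cont dGE; have cb := cont_bump; have cdb := cont_dbump.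
have li0 : 0 < l^-1 by rewrite invr_gt0.
have out x : x <= l / 2 \/ l <= x -> bump (l^-1 * x) = 0 /\ dbump (l^-1 * x) = 0.
  by move=> h; apply: bump_out; rewrite ler_pdivrMl// ler_pdivlMl// mulr1.
have z x : x <= l / 2 \/ l <= x -> c * (bump (l^-1 * x) * G x) = 0 /\
   c * (l^-1 * dbump (l^-1 * x) * G x + bump (l^-1 * x) * dG x) = 0.
  by move=> /out[-> ->]; rewrite !(mulr0, mul0r) addr0 mulr0.
split.
- by cont.
- move=> x; have dl : is_derive x (1 : R) (fun t : R => l^-1 * t) l^-1.
    by apply: (der_eq (derZ l^-1 (der_id x))); rewrite mulr1.
  apply: (der_eq (derZ c (derM (@der_comp _ bump (fun t => l^-1 * t) x _ _ (der_bump _) dl) (dGE x)))).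
  by ring.
- by move=> x x0; apply: z; left; rewrite (le_trans x0)// divr_ge0// ltW.
- by move=> x xl; apply: z; right.
- move=> x; have [xl|/ltW lx] := leP x (l / 2).
    have [-> ->] := z _ (or_introl xl); rewrite normr0.
    by rewrite !mulr_ge0// ?addr_ge0// ltW.
  have [G1 G2] := GB _ lx; have [b1 b2] := bump_bound (l^-1 * x).
  have GG : `|bump (l^-1 * x) * G x| <= eta.
    by rewrite normrM -[leRHS]mul1r; apply: ler_pM.
  have GdG : `|bump (l^-1 * x) * dG x| <= eta * K.
    by rewrite normrM -[leRHS]mul1r; apply: ler_pM.
  have dGG : `|l^-1 * dbump (l^-1 * x) * G x| <= l^-1 * eta.
    rewrite -mulrA normrM (gtr0_norm li0) ler_wpM2l ?(ltW li0)//.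
    by rewrite normrM -[leRHS]mul1r; apply: ler_pM.
  have h1 := mulr_ge0 eta0 (ltW li0); have h2 := mulr_ge0 eta0 K0.
  split; rewrite normrM (ger0_norm c0) ler_wpM2l//.
    by rewrite (le_trans GG)//; lra.
  by rewrite (le_trans (ler_normD _ _))//; lra.
Qed.

(** The size from [C1supp_bump] when [G] is a component of -exp(-mu t): the first factor normalises
    the mass of the bump rescaled to length [l], and the exponential is the modulus of exp(-mu t) at
    t = l / 2, where the bump begins. *)
Definition bump_size (mu : R[i]) (l : R) : R := (l * bump_mass)^-1 *
  (expR (- (complex.Re mu * l / 2)) * (1 + l^-1 + (`|complex.Re mu| + `|complex.Im mu|))).

Lemma complex_norm_bound (z w : R[i]) (eta : R) :
  `|complex.Re w| <= eta -> `|complex.Im w| <= eta ->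
  `|complex.Re (z * w)| <= eta * (`|complex.Re z| + `|complex.Im z|) /\
  `|complex.Im (z * w)| <= eta * (`|complex.Re z| + `|complex.Im z|).
Proof.
move=> h1 h2; rewrite Re_mul Im_mul; split.
  rewrite (le_trans (ler_normB _ _))// !normrM mulrDr ![eta * _]mulrC.
  by apply: lerD; apply: ler_pM.
rewrite (le_trans (ler_normD _ _))// !normrM mulrDr ![eta * _]mulrC.
by apply: lerD; apply: ler_pM.
Qed.

(* With [f + i h = - c bump(t/l) exp(-mu t)] one has [F + i H = -1] for the
   transforms, so that [(1 + F)^2 + H^2 = 0]. *)
Lemma bump_factor (mu : R[i]) (l : R) : 0 < complex.Re mu -> 0 < l ->
  l * bump_size mu l <= 2^-1 ->
  exists g dg, C1supp (l + l) (3 * bump_size mu l) g dg /\ 1 + laplace mu g (l + l) = 0.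
Proof.
move=> mu0 l0 small; have I0 := bump_mass_gt0.
pose c := (l * bump_mass)^-1; pose eta := expR (- (complex.Re mu * l / 2)).
pose K := `|complex.Re mu| + `|complex.Im mu|.
have c0 : 0 < c by rewrite invr_gt0 mulr_gt0.
have eta0 : 0 <= eta by exact: expR_ge0.
have K0 : 0 <= K by exact: addr_ge0.
pose w t := - cexpr (- mu) t; pose dw t := mu * cexpr (- mu) t.
have dwE t : has_deriv w t (dw t).
  apply: (has_deriv_eq (f := w)); last by [].
  rewrite (_ : w = fun t => (-1) * cexpr (- mu) t); last by apply/funext => y; rewrite mulN1r.
  by apply: (has_deriv_eq (has_derivZ (-1) (has_deriv_cexpr _ t))); rewrite /dw; ring.
have [cdw1 cdw2] : ccont dw by apply: ccontM; [exact: ccont_cst|exact: ccont_cexpr].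
have eB t : l / 2 <= t -> `|complex.Re (cexpr (- mu) t)| <= eta /\ `|complex.Im (cexpr (- mu) t)| <= eta.
  move=> lt; have h : expR (complex.Re (- mu) * t) <= eta.
    by rewrite /eta ler_expR Re_opp mulNr lerN2 -mulrA ler_wpM2l// ltW.
  rewrite cexprE /= !normrM !(gtr0_norm (expR_gt0 _)); split.
    by rewrite -[leRHS]mulr1; apply: ler_pM => //; rewrite ler_norml cos_geN1 cos_le1.
  by rewrite -[leRHS]mulr1; apply: ler_pM => //; rewrite ler_norml sin_geN1 sin_le1.
have dwB t : l / 2 <= t -> `|complex.Re (dw t)| <= eta * K /\ `|complex.Im (dw t)| <= eta * K.
  by move=> /eB[h1 h2]; exact: complex_norm_bound.
have sf := @C1supp_bump l c eta K (fun t => complex.Re (w t)) (fun t => complex.Re (dw t))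
  l0 (ltW c0) eta0 K0 cdw1 (fun t => proj1 (dwE t)) _.
have sh := @C1supp_bump l c eta K (fun t => complex.Im (w t)) (fun t => complex.Im (dw t))
  l0 (ltW c0) eta0 K0 cdw2 (fun t => proj2 (dwE t)) _.
set f := fun t => c * (bump (l^-1 * t) * complex.Re (w t)) in sf.
set h := fun t => c * (bump (l^-1 * t) * complex.Im (w t)) in sh.
set df := fun t => c * (_ + _) in sf.
set dh := fun t => c * (_ + _) in sh.
have {}sf : C1supp l (bump_size mu l) f df.
  by apply: sf => t lt; split; [rewrite Re_opp normrN; case: (eB t lt)|case: (dwB t lt)].
have {}sh : C1supp l (bump_size mu l) h dh.
  by apply: sh => t lt; split; [rewrite Im_opp normrN; case: (eB t lt)|case: (dwB t lt)].
have ll : l <= l + l by rewrite lerDl ltW.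
have sff := C1supp_conv (ltW l0) sf sf; have shh := C1supp_conv (ltW l0) sh sh.
have sf2 := C1suppW ll (lexx _) sf.
(* The factor minus 1 is 2 F + F^2 + H^2, whence the supports of length 2 l. With b =
   [bump_size mu l] its size is 2 b + 2 l b^2, at most 3 b by [small]. *)
have sg := C1suppD (C1suppD (C1suppD sf2 sf2) sff) shh.
have e0 : 0 <= bump_size mu l.
  by case: (c1_bound sf 0) => b _; exact: le_trans b.
exists (fun x => f x + f x + conv l f f x + conv l h h x).
exists (fun x => df x + df x + conv l f df x + conv l h dh x); split.
  apply: C1suppW sg => //; have := ler_wpM2r e0 small; lra.
have cf := c1_contf sf; have ch := c1_contf sh.
have cff := c1_contf sff; have chh := c1_contf shh.
have cf2 : continuous (fun x => f x + f x) by cont.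
have cf3 : continuous (fun x => f x + f x + conv l f f x) by exact: contD.
rewrite (laplaceD mu _ cf3 chh) (laplaceD mu _ cf2 cff) (laplaceD mu _ cf cf).
rewrite (laplace_widen mu (ltW l0) ll sf) (laplace_conv mu (ltW l0) (ltW l0) sf sf)
  (laplace_conv mu (ltW l0) (ltW l0) sh sh).
have key : laplace mu f l + 'i%C * laplace mu h l = -1; last first.
  set F := laplace mu f l in key *; set Hh := laplace mu h l in key *.
  have -> : F = -1 - 'i%C * Hh by rewrite -key addrK.
  have i2 : 'i%C * 'i%C = -1 :> R[i] by rewrite -expr2 sqr_i.
  rewrite (_ : 1 + _ = Hh * Hh * (1 + 'i%C * 'i%C)); first by rewrite i2 subrr mulr0.
  by ring.
pose E1 y := complex.Re (cexpr mu y); pose E2 y := complex.Im (cexpr mu y).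
have [cE1 cE2] : continuous E1 /\ continuous E2 by exact: ccont_cexpr.
have lapE u : laplace mu u l = cint (fun y => u y * E1 y) 0 l +i* cint (fun y => u y * E2 y) 0 l by [].
have cfE e1 : continuous e1 -> continuous (fun y => f y * e1 y) by move=> ?; cont.
have chE e1 : continuous e1 -> continuous (fun y => h y * e1 y) by move=> ?; cont.
(* The exponentials cancel pointwise: (f + i h) e^{mu y} is the real function -c bump(y / l), and
   [c] makes its integral -1. *)
have we y : w y * cexpr mu y = -1.
  rewrite mulNr !cexprE; apply: complex_ext; rewrite ?Re_opp ?Im_opp ?Re_mul ?Im_mul /= ?Re_opp ?Im_opp !mulNr cosN sinN.
    rewrite (_ : _ - _ = (expR (- (complex.Re mu * y)) * expR (complex.Re mu * y)) *
       (cos (complex.Im mu * y) ^+ 2 + sin (complex.Im mu * y) ^+ 2)); last by ring.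
    by rewrite cos2Dsin2 -expRD addNr expR0 mulr1.
  by rewrite oppr0; ring.
have cb := cont_bump.
have Ib : cint (fun y => bump (l^-1 * y)) 0 l = l * bump_mass.
  have := @cint_affine _ bump l^-1 0 0 l cb; rewrite !addr0 mulr0 mulVf ?gt_eqF// cintZ; last by cont.
  move=> E; rewrite /bump_mass -E mulrA divff ?gt_eqF// mul1r.
  by apply: (congr1 (fun u => cint u 0 l)); apply/funext => y; rewrite addr0.
rewrite !lapE; apply: complex_ext; rewrite ?Re_add ?Im_add ?Re_mul ?Im_mul /= !(mul0r, mul1r, add0r, sub0r, addr0).
  rewrite -cintB; [|exact: cfE|exact: chE].
  transitivity (cint (fun y => - c * bump (l^-1 * y)) 0 l).
    apply: (congr1 (fun u => cint u 0 l)); apply/funext => y.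
    have E : complex.Re (w y) * E1 y - complex.Im (w y) * E2 y = -1.
      by rewrite /E1 /E2 -Re_mul we.
    rewrite /f /h (_ : _ - _ = c * bump (l^-1 * y) * (complex.Re (w y) * E1 y -
      complex.Im (w y) * E2 y)); last by ring.
    by rewrite E; ring.
  rewrite cintZ; last by cont.
  by rewrite Ib /c mulNr mulVf// gt_eqF// mulr_gt0.
rewrite -cintD; [|exact: cfE|exact: chE].
transitivity (cint (fun=> 0 : R) 0 l); last by rewrite cint0 oppr0.
apply: (congr1 (fun u => cint u 0 l)); apply/funext => y.
have E : complex.Re (w y) * E2 y + complex.Im (w y) * E1 y = 0.
  by rewrite /E1 /E2 -Im_mul we /= oppr0.
rewrite /f /h (_ : _ + _ = c * bump (l^-1 * y) * (complex.Re (w y) * E2 y +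
  complex.Im (w y) * E1 y)); last by ring.
by rewrite E; ring.
Qed.
End Bump.

(** * Summation over resonances *)

Section Sums.
Context {R : realType}.

Lemma gt0_powRE (a x : R) : 0 < a -> a `^ x = expR (x * ln a).
Proof. by move=> a0; rewrite /powR gt_eqF. Qed.

Lemma sum_subseq_le (T : eqType) (s1 s2 : seq T) (F : T -> R) : uniq s1 -> uniq s2 ->
  {subset s1 <= s2} -> (forall x, 0 <= F x) -> \sum_(x <- s1) F x <= \sum_(x <- s2) F x.
Proof.
move=> u1 u2 s12 F0.
have p : perm_eq [seq x <- s2 | x \in s1] s1.
  apply: uniq_perm; rewrite ?filter_uniq// => x; rewrite mem_filter.
  by apply: andb_idr; exact: s12.
rewrite -(perm_big _ p) big_filter [leRHS](bigID (mem s1)) /= lerDl.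
exact: sumr_ge0.
Qed.

Lemma counting_size_le (Lambda : set R[i]) (r m : R) (s : seq R[i]) :
  (counting_function Lambda r <= m%:E)%E -> uniq s ->
  (forall z, z \in s -> Lambda z /\ normc z < r) -> (size s)%:R <= m.
Proof.
rewrite /counting_function /counting; case: ifPn => // /asboolP fin.
rewrite lee_fin => le_m us sL; apply: le_trans le_m; rewrite ler_nat.
apply: uniq_leq_size => // z /sL zs.
have : z \in fset_set [set z : R[i] | Lambda z /\ normc z < r].
  by rewrite in_fset_set//; exact: mem_set.
by [].
Qed.

Lemma counting_finite (Lambda : set R[i]) (r m : R) :
  (counting_function Lambda r <= m%:E)%E ->
  finite_set [set z : R[i] | Lambda z /\ normc z < r].
Proof. by rewrite /counting_function /counting; case: ifPn => // /asboolP. Qed.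

(* [r^-b <= sum_j [r < 2^(j+1)] 2^(-jb)] because of the term with [2^j <= r < 2^(j+1)]. *)
Lemma dyadic_sum_le (Lambda : set R[i]) (al b M : R) : 0 <= al -> al < b -> 0 < M ->
  (forall r : R, 1 <= r -> (counting_function Lambda r <= (M * r `^ al)%:E)%E) ->
  exists2 S : R, 0 <= S & forall s : seq R[i], uniq s ->
    (forall z, z \in s -> Lambda z /\ 1 <= normc z) ->
    \sum_(z <- s) normc z `^ (- b) <= S.
Proof.
move=> al0 alb M0 Hc.
pose ln2 : R := ln 2; have ln2_gt0 : 0 < ln2 by rewrite ln_gt0// ltr1n.
(* At scale j there are at most M 2^{(j+1) al} points of weight 2^{-jb}, that is M 2^{al} rho^j with
   rho = 2^{-(b - al)}. *)
pose rho := expR (- ((b - al) * ln2)).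
have rho0 : 0 <= rho by exact: expR_ge0.
have rho1 : rho < 1 by rewrite -expR0 ltr_expR oppr_lt0 mulr_gt0// subr_gt0.
exists (M * expR (al * ln2) / (1 - rho)).
  by rewrite !mulr_ge0 ?expR_ge0// ?invr_ge0 ?subr_ge0 ltW.
move=> s us sL.
(* [w j] is 2^{-jb} and [t j] is 2^{j+1}, as exponentials so that comparisons reduce to
   exponents. *)
pose w (j : nat) : R := expR (- (j%:R * b * ln2)).
pose t (j : nat) : R := expR (j.+1%:R * ln2).
have [J HJ] : exists J : nat, forall z, z \in s -> normc z < t J.
  elim: s {us sL} => [|z s [J IH]]; first by exists 0%N.
  exists (maxn J (Num.truncn (normc z / ln2)).+1) => y; rewrite inE => /predU1P[->|ys].
    apply: (@lt_le_trans _ _ (expR ((Num.truncn (normc z / ln2)).+1%:R * ln2))).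
      have := truncnS_gt (normc z / ln2); rewrite ltr_pdivrMr// => /lt_le_trans; apply.
      by have := expR_ge1Dx ((Num.truncn (normc z / ln2)).+1%:R * ln2); lra.
    by rewrite /t ler_expR ler_wpM2r ?(ltW ln2_gt0)// ler_nat leqW// leq_maxr.
  apply: (lt_le_trans (IH _ ys)); rewrite /t ler_expR ler_wpM2r ?(ltW ln2_gt0)//.
  by rewrite ler_nat ltnS leq_maxl.
pose ind (z : R[i]) (j : nat) : R := if normc z < t j then 1 else 0.
have ind0 z j : 0 <= ind z j by rewrite /ind; case: ifP.
have key (z : R[i]) : z \in s -> normc z `^ (- b) <= \sum_(j < J.+1) ind z j * w j.
  move=> zs; have [_ z1] := sL z zs; have z0 : 0 < normc z by exact: lt_le_trans z1.
  have ex : exists j, normc z < t j by exists J; exact: HJ.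
  pose j := ex_minn ex.
  have [ztj jmin] : normc z < t j /\ forall k, normc z < t k -> (j <= k)%N.
    by rewrite /j; case: ex_minnP.
  have jJ : (j < J.+1)%N by rewrite ltnS jmin// HJ.
  rewrite (bigD1 (Ordinal jJ))//= {1}/ind ztj mul1r.
  apply: (@le_trans _ _ (w j)); last first.
    by rewrite lerDl sumr_ge0// => i _; rewrite mulr_ge0// expR_ge0.
  rewrite gt0_powRE// ler_expR mulNr lerN2 mulrAC [leRHS]mulrC ler_wpM2r//; first by lra.
  case: (posnP j) => [->|j0]; first by rewrite mul0r ln_ge0.
  have : t j.-1 <= normc z.
    by rewrite leNgt; apply/negP => /jmin; rewrite -ltnS prednK// ltnn.
  by rewrite /t prednK// => h; rewrite -[leLHS]expRK ler_ln ?posrE ?expR_gt0.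
apply: (@le_trans _ _ (\sum_(z <- s) \sum_(j < J.+1) ind z j * w j)).
  rewrite big_seq [leRHS]big_seq; exact: ler_sum.
rewrite exchange_big /=.
apply: (@le_trans _ _ (\sum_(j < J.+1) M * expR (al * ln2) * rho ^+ j)); last first.
  rewrite -mulr_sumr ler_wpM2l ?geometric_sum_le// mulr_ge0 ?expR_ge0//; exact: ltW.
apply: ler_sum => j _; rewrite -mulr_suml.
have cnt : \sum_(z <- s) ind z j = (size [seq z <- s | normc z < t j])%:R :> R.
  by rewrite size_filter -sum1_count natr_sum [RHS]big_mkcond; apply: eq_bigr => z _; rewrite /ind; case: ifP.
have t1 : 1 <= t j by rewrite -expR0 ler_expR mulr_ge0// ltW.
have : \sum_(z <- s) ind z j <= M * t j `^ al.
  rewrite cnt; apply: counting_size_le (Hc _ t1) _ _; first exact: filter_uniq.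
  by move=> z; rewrite mem_filter => /andP[-> /sL[]].
move=> /(ler_wpM2r (expR_ge0 (- (j%:R * b * ln2)))) /le_trans; apply.
rewrite /t gt0_powRE ?expR_gt0// expRK -!mulrA ler_wpM2l ?(ltW M0)//.
rewrite /rho -expRM_natl -!expRD ler_expR -addn1 natrD; lra.
Qed.

(* Up to constants, both the length and the size of the layer that creates the
   resonance [z] are bounded by its cost. *)
Definition cost (beta : R) (z : R[i]) : R := (1 + ln (2 + normc z)) * normc z `^ (- beta).

Lemma normc_nonneg (z : R[i]) : 0 <= normc z.
Proof. by case: z => x y /=; exact: sqrtr_ge0. Qed.

Lemma ln2D_ge0 (z : R[i]) : 0 <= ln (2 + normc z).
Proof. by apply: ln_ge0; have := normc_nonneg z; lra. Qed.

Lemma cost_ge0 beta (z : R[i]) : 0 <= cost beta z.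
Proof. by rewrite mulr_ge0 ?powR_ge0// addr_ge0// ln2D_ge0. Qed.

(** Half of the gap between the exponents, [ga], absorbs the logarithm, and the other half keeps
    [beta - ga] above [al] for the dyadic sum. The points with [normc z < 1] are finitely many and
    are summed apart. A negative [alpha] may be raised to 0, since for r >= 1 this only weakens the
    count. *)
Lemma cost_bounded (Lambda : set R[i]) (alpha beta M : R) : 0 < beta -> alpha < beta -> 0 < M ->
  (forall r : R, 0 < r -> (counting_function Lambda r <= (M * r `^ alpha)%:E)%E) ->
  exists2 S : R, 1 <= S & forall s : seq R[i], uniq s ->
    (forall z, z \in s -> Lambda z) -> \sum_(z <- s) cost beta z <= S.
Proof.
move=> beta0 ab M0 Hc.
pose al := Num.max alpha 0; have al0 : 0 <= al by rewrite le_max lexx orbT.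
have alb : al < beta by rewrite gt_max ab.
pose ga := (beta - al) / 2; have ga0 : 0 < ga by rewrite divr_gt0// subr_gt0.
have Hc' (r : R) : 1 <= r -> (counting_function Lambda r <= (M * r `^ al)%:E)%E.
  move=> r1; apply: (le_trans (Hc r (lt_le_trans ltr01 r1))).
  by rewrite lee_fin ler_wpM2l ?(ltW M0)// ler_powR// le_max lexx.
have [|S S0 HS] := @dyadic_sum_le Lambda al (beta - ga) M al0 _ M0 Hc'.
  by rewrite /ga; lra.
(* For r >= 1, 1 + ln(2 + r) <= 3 + ln r <= (3 + 1 / ga) r^{ga}, because ln r <= r^{ga} / ga. *)
pose K := 3 + ga^-1; have K0 : 0 <= K by rewrite addr_ge0// invr_ge0 ltW.
have cost_le (z : R[i]) : 1 <= normc z -> cost beta z <= K * normc z `^ (- (beta - ga)).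
  move=> z1; have z0 : 0 < normc z by exact: lt_le_trans z1.
  have -> : - (beta - ga) = ga + - beta by rewrite opprB.
  rewrite powRD; last by rewrite (gt_eqF z0) implybT.
  rewrite mulrA ler_wpM2r ?powR_ge0//.
  set p := normc z `^ ga.
  have pE : p = expR (ga * ln (normc z)) by exact: gt0_powRE.
  have lz : 0 <= ln (normc z) by exact: ln_ge0.
  have p1 : 1 <= p by rewrite pE -expR0 ler_expR mulr_ge0// ltW.
  have h1 : ln (2 + normc z) <= 2 + ln (normc z).
    have h3 : ln (1 + 2) <= (2 : R) by apply: le_ln1Dx; lra.
    apply: (@le_trans _ _ (ln ((1 + 2) * normc z))); last first.
      by rewrite lnM ?posrE ?lerD2r//; lra.
    by rewrite ler_ln ?posrE; lra.
  have h2 : ln (normc z) <= ga^-1 * p.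
    rewrite ler_pdivlMl// pE; have := expR_ge1Dx (ga * ln (normc z)); lra.
  rewrite /K mulrDl; lra.
have fin : finite_set [set z : R[i] | Lambda z /\ normc z < 1] := counting_finite (Hc 1 ltr01).
pose A1 : seq R[i] := finmap.enum_fset (fset_set [set z : R[i] | Lambda z /\ normc z < 1]).
pose S1 := \sum_(z <- A1) cost beta z.
have S10 : 0 <= S1 by apply: sumr_ge0 => z _; exact: cost_ge0.
exists (S1 + K * S + 1); first by have := mulr_ge0 K0 S0; lra.
move=> s us sL; rewrite (bigID (fun z : R[i] => normc z < 1)) /=.
rewrite -!(big_filter s).
have b1 : \sum_(z <- [seq z <- s | normc z < 1]) cost beta z <= S1.
  apply: sum_subseq_le.
  - exact: filter_uniq.
  - exact: finmap.fset_uniq.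
  - move=> z; rewrite mem_filter => /andP[z1 zs]; rewrite /A1.
    have : z \in fset_set [set z : R[i] | Lambda z /\ normc z < 1].
      by rewrite in_fset_set//; apply: mem_set; split => //; exact: sL.
    by [].
  - by move=> z; exact: cost_ge0.
have b2 : \sum_(z <- [seq z <- s | ~~ (normc z < 1)]) cost beta z <= K * S.
  apply: (@le_trans _ _ (\sum_(z <- [seq z <- s | ~~ (normc z < 1)]) K * normc z `^ (- (beta - ga)))).
    rewrite big_seq [leRHS]big_seq; apply: ler_sum => z.
    by rewrite mem_filter -leNgt => /andP[z1 _]; exact: cost_le.
  rewrite -mulr_sumr ler_wpM2l//; apply: HS; first exact: filter_uniq.
  by move=> z; rewrite mem_filter -leNgt => /andP[z1 zs]; split => //; exact: sL.
lra.
Qed.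

Lemma counting_countable (Lambda : set R[i]) (m : R -> R) :
  (forall r : R, 0 < r -> (counting_function Lambda r <= (m r)%:E)%E) -> countable Lambda.
Proof.
move=> Hc; rewrite (_ : Lambda = \bigcup_(n in [set: nat]) [set z : R[i] | Lambda z /\ normc z < n.+1%:R]).
  apply: bigcup_countable => // n _; apply: finite_set_countable.
  by apply: (counting_finite (Hc n.+1%:R _)); rewrite ltr0n.
apply/seteqP; split => [z Lz|z [n _ []]//].
by exists (Num.truncn (normc z)) => //; split => //; exact: truncnS_gt.
Qed.

(** An injection into [nat] has only a partial inverse, and [None] fills its gaps at cost 0.
    Injectivity makes each initial segment duplicate-free, so the bound on finite lists applies. *)
Lemma enumerate_sum (T : choiceType) (A : set T) (c : T -> R) (S : R) : countable A ->
  (forall s : seq T, uniq s -> (forall z, z \in s -> A z) -> \sum_(z <- s) c z <= S) ->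
  exists x : nat -> option T,
    [/\ forall n z, x n = Some z -> A z, forall z, A z -> exists n, x n = Some z
      & forall n, \sum_(i < n) oapp c 0 (x i) <= S].
Proof.
move=> /countable_injP[f finj] cS.
pose P n z := A z /\ f z = n.
pose x n := if pselect (exists z, P n z) is left h then Some (projT1 (cid h)) else None.
have xP n z : x n = Some z -> A z /\ f z = n.
  by rewrite /x; case: pselect => // h [<-]; case: cid.
exists x; split.
- by move=> n z /xP[].
- move=> z Az; exists (f z); rewrite /x; case: pselect => [h|[]]; last by exists z.
  congr Some; case: cid => y /= [Ay fy]; apply: finj => //; exact: mem_set.
move=> n.
have -> : \sum_(i < n) oapp c 0 (x i) = \sum_(z <- pmap x (iota 0 n)) c z.
  rewrite -(big_mkord xpredT (fun i => oapp c 0 (x i))) /index_iota subn0.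
  elim: (iota 0 n) => [|i t IH]; first by rewrite !big_nil.
  rewrite big_cons IH /=; case: (x i) => [z|] /=; first by rewrite big_cons.
  by rewrite add0r.
apply: cS.
  apply: (@pmap_uniq _ _ x f) (iota_uniq _ _) => i.
  by case E : (x i) => [z|] //=; case: (xP _ _ E).
by move=> z; rewrite mem_pmap => /mapP[i _ /esym /xP[]].
Qed.

Lemma exists_large (K N m : R) : exists D : R, [/\ m <= D, 1 <= D & K * (D + N) ^+ 2 <= expR D].
Proof.
(* D >= |N| gives (D + N)^2 <= 4 D^2, while e^D >= (D / 4)^4 = D^4 / 256. It remains to have 1024
   |K| <= D^2, which follows from 1024 |K| <= D and D >= 1. *)
pose D := `|m| + `|N| + 1024 * `|K| + 1.
have m0 := normr_ge0 m; have N0 := normr_ge0 N; have K0 := normr_ge0 K.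
have [hm hN hK] : [/\ m <= `|m|, N <= `|N| & K <= `|K|] by rewrite !ler_norm.
have hN' : - N <= `|N| by rewrite -normrN ler_norm.
have D1 : 1 <= D by rewrite /D; lra.
exists D; split => //; first by rewrite /D; lra.
have e4 : (D / 4) ^+ 4 <= expR D.
  have -> : expR D = expR (D / 4) ^+ 4 by rewrite -expRM_natl; congr expR; field.
  have := expR_ge1Dx (D / 4) => h.
  by rewrite lerXn2r ?nnegrE ?expR_ge0//; lra.
apply: le_trans e4.
have h1 : (D + N) ^+ 2 <= 4 * D ^+ 2.
  rewrite (_ : 4 * D ^+ 2 = (2 * D) ^+ 2); last by ring.
  by rewrite lerXn2r ?nnegrE//; rewrite /D; lra.
have h2 : K * (D + N) ^+ 2 <= `|K| * (4 * D ^+ 2).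
  by rewrite (le_trans (ler_wpM2r (sqr_ge0 _) hK))// ler_wpM2l.
apply: (le_trans h2).
rewrite (_ : (D / 4) ^+ 4 = (D ^+ 2 / 256) * D ^+ 2); last by field.
rewrite mulrA ler_wpM2r ?sqr_ge0//.
have : 1024 * `|K| <= D by rewrite /D; lra.
by nra.
Qed.
End Sums.

(** * Calibration of one factor, and integrability of the potential *)

Section ResonanceFactor.
Context {R : realType}.

Lemma ler_norm_normc (z : R[i]) : `|complex.Re z| <= normc z /\ `|complex.Im z| <= normc z.
Proof.
case: z => x y /=; rewrite -!sqrtr_sqr !ler_wsqrtr//.
  by rewrite lerDr sqr_ge0.
by rewrite lerDl sqr_ge0.
Qed.

(** The support has length 2 y / |Im z| with y = D + (beta + 2) ln(2 + |z|). The domain condition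
    bounds 1 / |Im z| by |z|^{-beta} / C, and y is at most (D + beta + 2)(1 + ln(2 + |z|)). *)
Definition layer_length (C beta D : R) : R := 2 / C * (D + (beta + 2)).
(** 36 is 3, lost in [bump_factor], times 12, from the polynomial prefactor of [bump_size]. *)
Definition layer_size (D : R) : R := 36 / @bump_mass R * expR (- D).

(** The length l is chosen so that the exponential in [bump_size] is e^{-y} = e^{-D} (2 +
    |z|)^{-(beta + 2)}. Two of these powers pay for the prefactor, of order (2 + |z|)^2, and the
    remaining [beta] leave |z|^{-beta}. *)
Lemma resonance_factor (C beta D : R) (z : R[i]) : 0 < C -> 0 < beta -> 1 <= D ->
  complex.Im z < 0 -> C * normc z `^ beta <= - complex.Im z ->
  layer_length C beta D * cost beta z * (layer_size D * cost beta z) <= 2^-1 ->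
  exists g dg, C1supp (layer_length C beta D * cost beta z) (layer_size D * cost beta z) g dg /\
    1 + laplace (2 * ('i%C * z)) g (layer_length C beta D * cost beta z) = 0.
Proof.
move=> C0 beta0 D1 Iz zC small.
have I0 : 0 < @bump_mass R := bump_mass_gt0.
have [zr1 zr2] := ler_norm_normc z.
set r := normc z in zC zr1 zr2 *.
have r0 : 0 < r.
  by apply: lt_le_trans zr2; rewrite normr_gt0 lt_eqF.
set mu := 2 * ('i%C * z).
have Remu : complex.Re mu = 2 * - complex.Im z.
  by rewrite /mu; case: (z) => u v; rewrite Re_mul Im_mul Re_mul /=; ring.
have Immu : complex.Im mu = 2 * complex.Re z.
  by rewrite /mu; case: (z) => u v; rewrite !Im_mul Re_mul /=; ring.
pose L := ln (2 + r); have L0 : 0 <= L by exact: ln2D_ge0.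
pose P := r `^ (- beta); have P0 : 0 <= P by exact: powR_ge0.
have PE : P = expR (- beta * ln r) by exact: gt0_powRE.
have costE : cost beta z = (1 + L) * P by [].
have Pcost : P <= cost beta z by rewrite costE ler_peMl//; lra.
set N := beta + 2; have N0 : 0 < N by rewrite /N; lra.
pose y := D + N * L; have y1 : 1 <= y by have := mulr_ge0 (ltW N0) L0; rewrite /y; lra.
have mu0 : 0 < complex.Re mu by rewrite Remu; lra.
pose l := 2 * y / complex.Re mu.
have l0 : 0 < l by rewrite divr_gt0//; lra.
have ll : l + l <= layer_length C beta D * cost beta z.
  have rb0 : 0 < C * r `^ beta by rewrite mulr_gt0// powR_gt0.
  have -> : l + l = 2 * y / - complex.Im z.
    by rewrite /l Remu; field; rewrite lt_eqF.
  apply: (@le_trans _ _ (2 * y / (C * r `^ beta))).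
    by rewrite ler_wpM2l ?mulr_ge0//; [lra|rewrite lef_pV2 ?posrE//; lra].
  have -> : 2 * y / (C * r `^ beta) = 2 / C * (y * P).
    by rewrite /P powRN; field; rewrite !gt_eqF ?powR_gt0.
  rewrite /layer_length -[leRHS]mulrA ler_wpM2l ?divr_ge0 ?(ltW C0)// costE mulrA ler_wpM2r//.
  have DL : 0 <= D * L by apply: mulr_ge0 => //; lra.
  by rewrite /y -/N; lra.
have size_le : 3 * bump_size mu l <= layer_size D * cost beta z.
  have muE : complex.Re mu * l / 2 = y by rewrite /l; field; rewrite gt_eqF.
  have li : l^-1 <= 2 * r.
    rewrite /l invf_div ler_pdivrMr; last by lra.
    have : complex.Re mu <= 2 * r.
      by rewrite Remu ler_wpM2l// (le_trans _ zr2)// -normrN ler_norm.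
    by nra.
  have li0 : 0 <= l^-1 by rewrite invr_ge0 ltW.
  have rE : 2 + r = expR L by rewrite lnK// posrE; lra.
  have EP : (2 + r) ^+ 2 * expR (- y) <= expR (- D) * P.
    rewrite rE -expRM_natl -expRD PE -expRD ler_expR.
    have : ln r <= L by rewrite ler_ln ?posrE; lra.
    by move=> /(ler_wpM2l (ltW beta0)); rewrite /y /N; lra.
  have Kle : 1 + l^-1 + (`|complex.Re mu| + `|complex.Im mu|) <= 1 + 6 * r.
    rewrite Remu Immu !normrM normrN !(@ger0_norm _ 2)//; lra.
  have K0 : 0 <= 1 + l^-1 + (`|complex.Re mu| + `|complex.Im mu|).
    by rewrite !addr_ge0.
  have step : l^-1 * (1 + l^-1 + (`|complex.Re mu| + `|complex.Im mu|)) <= 12 * (2 + r) ^+ 2.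
    by apply: (le_trans (ler_pM li0 K0 li Kle)); nra.
  rewrite /bump_size muE invfM.
  have -> : 3 * (l^-1 * bump_mass^-1 * (expR (- y) * (1 + l^-1 + (`|complex.Re mu| + `|complex.Im mu|)))) =
     3 / bump_mass * ((l^-1 * (1 + l^-1 + (`|complex.Re mu| + `|complex.Im mu|))) * expR (- y)) by ring.
  have -> : layer_size D * cost beta z = 3 / bump_mass * (12 * (expR (- D) * cost beta z)).
    by rewrite /layer_size; ring.
  rewrite ler_wpM2l ?divr_ge0 ?(ltW I0)//.
  apply: (le_trans (ler_wpM2r (expR_ge0 _) step)).
  rewrite -mulrA ler_wpM2l// (le_trans EP)// ler_wpM2l ?expR_ge0//.
have small' : l * bump_size mu l <= 2^-1.
  apply: le_trans small.
  have b0 : 0 <= bump_size mu l.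
    apply: mulr_ge0; first by rewrite invr_ge0 mulr_ge0// ltW.
    apply: mulr_ge0; first exact: expR_ge0.
    by rewrite !addr_ge0// invr_ge0 ltW.
  by apply: ler_pM => //; [exact: ltW|lra|lra].
have [g [dg [sg lg]]] := bump_factor mu0 l0 small'.
exists g, dg; split; first exact: C1suppW sg.
by rewrite (laplace_widen mu _ ll sg)// addr_ge0// ltW.
Qed.

Lemma cont_potential_admissible (q : R -> R) (a : R) : 0 < a -> continuous q ->
  (forall x : R, a <= x -> q x = 0) ->
  (@lebesgue_measure R).-integrable `[0, +oo[ (EFin \o q) /\ compactly_supported q.
Proof.
move=> a0 cq q0; split.
  have := @cont_integrable R q 0 a cq.
  rewrite integrable_mkcond// => /=; rewrite [X in _ -> X]integrable_mkcond//=.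
  rewrite (_ : (EFin \o q) \_ `[0, a] = (EFin \o q) \_ `[0, +oo[)//.
  apply/funext => x; rewrite /patch !mem_setE !in_itv /= andbT.
  by have [xa|/ltW ax] := leP x a; rewrite ?andbT// andbF q0//; case: ifP.
rewrite /compactly_supported; apply: (@subclosed_compact _ _ `[0, a]).
- exact: closed_closure.
- exact: segment_compact.
rewrite [X in _ `<=` X](proj1 (closure_id _) (@itv_closed _ R 0 a)).
apply: closureS => x [x0 /eqP qx] /=; rewrite in_itv /= x0 /=.
by rewrite leNgt; apply/negP => /ltW /q0.
Qed.
End ResonanceFactor.

Theorem theorem1p2 (R : realType) (Lambda : set R[i]) (C beta alpha M : R)
  (HLambda : Lambda `<=` [set z : R[i] | complex.Im z < 0])
  (HC : 0 < C) (Hbeta : 0 < beta)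
  (Hdomain : Lambda `<=` [set z : R[i] | - complex.Im z >= C * normc z `^ beta])
  (Halpha : alpha < beta) (HM : 0 < M)
  (Hcount : forall r : R, 0 < r ->
     (counting_function Lambda r <= (M * r `^ alpha)%:E)%E) :
  exists q : R -> R,
    [/\ (@lebesgue_measure R).-integrable `[0, +oo[ (EFin \o q),
        compactly_supported q &
        Lambda `<=` resonances q].
Proof.
have [S S1 HS] := cost_bounded Hbeta Halpha HM Hcount.
have S0 : 0 < S by exact: lt_le_trans S1.
have [x [xL Lx xS]] := enumerate_sum (counting_countable Hcount) HS.
have I0 : 0 < @bump_mass R := bump_mass_gt0.
(* 4608 = 16 * 2 * 36 * 4 makes [a ^+ 2 * (2 * E) <= 1 / 16] equivalent to [HD]. *)
pose K := 4608 * S ^+ 3 / (C ^+ 2 * bump_mass).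
have [D [CD D1 HD]] := exists_large K (beta + 2) C.
pose kap := layer_length C beta D; pose eps := layer_size D.
(* From [CD]. Together with [S1] it gives a >= 1, hence a <= a^2, so that the smallness for the
   inverse problem implies the one for the product. *)
have kap1 : 1 <= kap.
  by rewrite /kap /layer_length mulrAC ler_pdivlMr//; lra.
have kap0 : 0 <= kap by exact: le_trans kap1.
have eps0 : 0 <= eps by rewrite mulr_ge0 ?expR_ge0// divr_ge0// ltW.
pose a := kap * S; pose E := eps * S.
have a1 : 1 <= a by rewrite /a -[leLHS]mulr1 ler_pM.
have a0 : 0 < a by exact: lt_le_trans a1.
have E0 : 0 <= E by rewrite mulr_ge0// ltW.
have small : a ^+ 2 * (2 * E) <= 16^-1.
  have -> : a ^+ 2 * (2 * E) = K * (D + (beta + 2)) ^+ 2 / expR D / 16.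
    rewrite /K /a /E /kap /eps /layer_length /layer_size expRN; field.
    by rewrite !gt_eqF ?expR_gt0.
  have : K * (D + (beta + 2)) ^+ 2 / expR D <= 1 by rewrite ler_pdivrMr ?expR_gt0// mul1r.
  by move: (_ / expR D) => t; lra.
have aE : a * E <= 2^-1.
  have aa : a <= a ^+ 2 by rewrite expr2 ler_peMl// ltW.
  by have := ler_wpM2r (mulr_ge0 (ler0n R 2) E0) aa; lra.
pose c n := oapp (cost beta) 0 (x n).
have c0 n : 0 <= c n by rewrite /c; case: (x n) => [z|] //=; exact: cost_ge0.
have cS z : Lambda z -> cost beta z <= S.
  move=> Lz; have := HS [:: z]; rewrite big_seq1; apply => //.
  by move=> y; rewrite inE => /eqP ->.
have /choice[gd Hgd] : forall n, exists gd : (R -> R) * (R -> R),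
    C1supp (kap * c n) (eps * c n) gd.1 gd.2 /\
    forall z, x n = Some z -> 1 + laplace (2 * ('i%C * z)) gd.1 (kap * c n) = 0.
  move=> n; rewrite /c; case xn : (x n) => [z|] /=.
    have Lz := xL _ _ xn.
    have [|g [dg [sg lg]]] := resonance_factor HC Hbeta D1 (HLambda _ Lz) (Hdomain _ Lz).
      apply: le_trans aE; rewrite -/kap -/eps.
      apply: ler_pM; [exact: (mulr_ge0 kap0 (cost_ge0 _ _))|exact: (mulr_ge0 eps0 (cost_ge0 _ _))
        |exact: (ler_wpM2l kap0 (cS _ Lz))|exact: (ler_wpM2l eps0 (cS _ Lz))].
    by exists (g, dg); split => // _ [<-].
  (* An index without a resonance gets the zero function, of length and size 0, so its factor is
     1. *)
  exists (fun=> 0, fun=> 0); split => //; rewrite !mulr0; split => //=.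
  - exact: cont_cst.
  - by move=> t; exact: der_cst.
  - by move=> t; rewrite normr0.
have [||||||A [dA [cdA dAE dA_le [Aa dAa] HA]]] := @infinite_product R a E (fun n => kap * c n)
  (fun n => eps * c n) (fun n => (gd n).1) (fun n => (gd n).2) a0.
- by move=> n; rewrite mulr_ge0.
- by move=> n; rewrite mulr_ge0.
- by move=> n; case: (Hgd n).
- by move=> n; rewrite -mulr_sumr ler_wpM2l ?kap0//; exact: xS.
- by move=> n; rewrite -mulr_sumr ler_wpM2l//; exact: xS.
- exact: aE.
have [q [H [[cq cH] q0 H0 HI HA2]]] :=
  small_inverse a0 (mulr_ge0 (ler0n R 2) E0) small cdA dAE dA_le Aa dAa.
have J := transmutation_jost a0 cq cH q0 H0 HI.
have [iq sq] := cont_potential_admissible a0 cq q0.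
exists q; split => // z Lz; split; first exact: HLambda.
have /choice[psi Hpsi] : forall k : R[i], exists psi : R -> R[i], jost_solution q k psi /\
    psi 0 = (1 + 2 * cint (fun y => H y y * complex.Re (cexpr (2 * ('i%C * k)) y)) 0 a) +i*
            (2 * cint (fun y => H y y * complex.Im (cexpr (2 * ('i%C * k)) y)) 0 a).
  by move=> k; have [psi ? ?] := J k; exists psi.
exists (fun k => psi k 0); first by move=> k; exists (psi k) => //; case: (Hpsi k).
have [n xn] := Lx _ Lz.
have [_ /(_ z xn) lz] := Hgd n.
have := HA _ _ lz; have [_ ->] := Hpsi z.
set mu := 2 * _; have [cE1 cE2] := @ccont_cexpr R mu.
have cA := der_cont dAE.
(* On the diagonal [H y y] is [A y / 2], so the value of psi at 0 is 1 + laplace (2 i z) A a, which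
   vanishes by [HA]. *)
have half e1 : continuous e1 -> 2 * cint (fun y => H y y * e1 y) 0 a = cint (fun y => A y * e1 y) 0 a.
  move=> ce; rewrite -cintZ; last by cont.
  apply: eq_cint; [exact: ltW|by cont|by cont|].
  by move=> y y0 ya; rewrite HA2 ?(ltW y0) ?(ltW ya)//; field.
by rewrite (half _ cE1) (half _ cE2) => <-; apply: complex_ext; rewrite ?Re_add ?Im_add /= ?add0r.
Qed.
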